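(* Let $G=\langle g_1,\dots,g_b\mid r_1(g_1,\dots,g_b),\dots,r_m(g_1,\dots,g_b)\rangle$ be a finitely presented group and let $\mathcal L=[(p_1,c_1),\dots,(p_k,c_k)]$ be a list of pairs with each $p_l$ a prime, $p_l\neq p_{l+1}$, and each $c_l$ a positive integer. Let $1\le i\le k$, $0\le j<c_i$, $p=p_i$. Let $K\cong G/\mathcal L_{i,j}(G)$ be a finite soluble group given by a labelled consistent power conjugate presentation $\{\mathcal A\mid\mathcal R\}$ refining the $\mathcal L$-series of $K$, and let $\theta:G\to K$ be a labelled epimorphism. Let $P=\mathcal L_{i,0}(K)$, let $H\cong G/\mathcal L_{i,j+1}(G)$ with epimorphisms $\tau:G\to H$ and $\phi:H\to K$ such that $\theta$ is $\tau$ followed by $\phi$, and let $N=\ker\phi$, which is an $\mathbb F_p(K/P)$-module under conjugation. Let $Z$ be the free $\mathbb F_p(K/P)$-module on $\{y_1,\dots,y_s,z_1,\dots,z_t\}$, let $T$ be the set of collected consistency test elements, and let $U=\{r_l(g_1^\sigma,\dots,g_b^\sigma)\mid 1\le l\le m\}$ be the set of elements of $Z$ obtained by evaluating the relators of $G$ in the images of the generators of $G$ under the extended map $\sigma$ (all as defined in the context). Then $N$ is isomorphic to $$Z/\bigl((T\cup U)\,\mathbb F_p(K/P)\bigr).$$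
   Context: **$\mathcal L$-series.** For a group $G$ and prime $p$, $\mathcal P^p_0(G)=G$ and $\mathcal P^p_l(G)=[\mathcal P^p_{l-1}(G),G]\,(\mathcal P^p_{l-1}(G))^p$ for $l\ge1$. For $\mathcal L=[(p_1,c_1),\dots,(p_k,c_k)]$ put $\mathcal L_{1,0}(G)=G$, $\mathcal L_{i,j}(G)=\mathcal P^{p_i}_j(\mathcal L_{i,0}(G))$ for $1\le j\le c_i$, $\mathcal L_{i+1,0}(G)=\mathcal L_{i,c_i}(G)$ for $i<k$, and $\mathcal L(G)=\mathcal L_{k,c_k}(G)$. The $\mathcal L$-series is the chain of all $\mathcal L_{i,j}(G)$. **Power conjugate presentations.** A power conjugate presentation $\{\mathcal A\mid\mathcal R\}$ has generators $\mathcal A=\{a_1,\dots,a_n\}$ and relations $a_l^{q_l}=v_{ll}$ ($1\le l\le n$, $q_l$ prime) and $a_k^{a_j}=v_{jk}$ ($1\le j<k\le n$), where $v_{jk}$ (for $j\le k$) is a normal word in $a_{j+1},\dots,a_n$. Here $x^y=y^{-1}xy$, and a word is normal if it is $a_1^{e_1}\cdots a_n^{e_n}$ with $0\le e_l<q_l$. The presentation is consistent if every element of the group is represented by a unique normal word. It refines the $\mathcal L$-series of $K$ if every term of that series is one of the subgroups $\langle a_l,\dots,a_n\rangle$ ($1\le l\le n+1$). In particular there is $r$ with $P=\langle a_{r+1},\dots,a_n\rangle$ and $K/P$ generated by $a_1P,\dots,a_rP$. **Labelled.** Let $d$ be the minimal number of generators in $\mathcal A$ required to generate $K$ (this is the generator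 number of $K$). $\{\mathcal A\mid\mathcal R\}$ is labelled if there is a $d$-element subset $\mathcal X\subseteq\mathcal A$ generating $K$ such that for each $a\in\mathcal A\setminus\mathcal X$ there is at least one relation of $\mathcal R$ having $a$ as the last generator on the right hand side, occurring with exponent 1, and exactly one of these relations has been chosen and is called the definition of $a$. For each $l$ let $w_l$ be the normal word equivalent to $\theta(g_l)$. The epimorphism $\theta$ is labelled if for each $a\in\mathcal X$ some $g_l$ has been chosen such that $a$ is the last generator of $w_l$, occurs with exponent 1, and is the only generator occurring in $w_l$ that lies in $\mathcal L_{k',c'}(K)$, where $k'$ and $c'$ are maximal with $a\in\mathcal L_{k',c'}(K)$; then $\theta(g_l)=w_l$ is called the definition of $a$. **Extended covering presentation.** Let $s$ be the number of relations in $\mathcal R$ that are not definitions, and let $t=b-d$ be the number of $g_l$ whose images under $\theta$ are not definitions. The group $\tilde K$ is given by generators $\{a_1,\dots,a_n,y_1,\dots,y_s,z_1,\dots,z_t\}$ and the following relations: (1) the relations of $\mathcal R$ which are definitions, unchanged; (2) for each non-defining relation $a_l^{q_l}=v_{ll}$ or $a_k^{a_j}=v_{jk}$ of $\mathcal R$, the modified relation $a_l^{q_l}=v_{ll}y_u$ or $a_k^{a_j}=v_{jk}y_u$, with different $y_u$ for different relations; (3) $[y_u,y_v^g]=1$ for all normal words $g$ in $a_1,\dots,a_r$, and $y_u^p=1$, for $1\le u,v\le s$; (4) $y_u^{a_l}=y_u$ for $l>r$ and $1\le u\le s$; (5) $[z_u,z_v^g]=1$, $[y_w,z_v^g]=1$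 and $[z_u,y_w^g]=1$ for all normal words $g$ in $a_1,\dots,a_r$, $1\le u,v\le t$, $1\le w\le s$, and $z_u^p=1$ for $1\le u\le t$; (6) $z_u^{a_l}=z_u$ for $l>r$ and $1\le u\le t$. **Extended map.** $g_l^\sigma=w_l\in\tilde K$ if $\theta(g_l)$ is a definition, and $g_l^\sigma=w_l z_v$ otherwise, with a different $z_v$ for each non-defining $g_l$. The relators $r_l$ are evaluated in $\tilde K$, and the values are written as collected words $v\prod_u y_u^{f_u}\prod_v z_v^{h_v}$ with $v$ a normal word in $a_1,\dots,a_n$ and $f_u,h_v\in\mathbb F_p(K/P)$ (the $z_v$ being treated in collection just like the $y_u$ below). Since $r_l$ is a relator of $G$, the part $v$ is trivial, so the value is regarded as an element of $Z$ (here $y^f$ denotes the module action, written multiplicatively). **The set $T$.** Let $Y$ be the free $\mathbb F_p(K/P)$-module on $y_1,\dots,y_s$ (a submodule of $Z$). A generalised normal word is $v\cdot\prod_u y_u^{f_u}$ with $v$ a normal word in $a_1,\dots,a_n$ and $f_u\in\mathbb F_p(K/P)$. Collection of a word in the $a_l$ and the symbols $y_u^{f}$ ($y_u=y_u^1$) applies, until a generalised normal word results, the replacements: $y_l^fy_k^{f'}\to y_k^{f'}y_l^f$ ($k<l$); $y_k^fy_k^{f'}\to y_k^{f+f'}$; $y_k^fa_l\to a_ly_k^{fa_l}$; $a_l^{q_l}\to v$, where $a_l^{q_l}=v$ is a relation in (1) or (2); $a_ja_l\to a_l v$ for $l<j$, where $a_j^{a_l}=v$ is a relation in (1) or (2).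 Round brackets mean: collect the bracketed word. $T$ is the set of elements of $Y$ obtained by collecting the words $\bigl(((a_ka_j)a_i)\,(a_k(a_ja_i))^{-1}\bigr)$ for $1\le i<j<k\le n$; $\bigl(((a_k^{q_k})a_j)\,(a_k^{q_k-1}(a_ka_j))^{-1}\bigr)$ for $1\le j<k\le n$; $\bigl(((a_ja_i)a_i^{q_i-1})\,(a_j(a_i^{q_i}))^{-1}\bigr)$ for $1\le i<j\le n$; $\bigl(((a_i^{q_i})a_i)\,(a_i(a_i^{q_i}))^{-1}\bigr)$ for $1\le i\le n$. Explicitly, the two factors of such a word collect to generalised normal words $v\prod y_u^{f_u}$ and $v\prod y_u^{f'_u}$ with the same $v$, and the resulting element of $Y$ is $\bigl(\sum_u y_u(f_u-f'_u)\bigr)\bar v^{-1}$, where $\bar v$ is the image of $v$ in $K/P$.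
   Formalization: The definitions in the labelled presentation are also required to be non-circular (generators can be ranked so each definition uses only lower-ranked ones); otherwise a_2^{a_1}=a_2 could define a_2 and the claim fails, e.g. for G=Z, K=C_6, L=[(2,1),(3,2)]. *)

(* Defs.v *)
From HB Require Import structures.
From Stdlib Require Import Relation_Operators.
Set Warnings "-notation-overridden,-ambiguous-paths,-redundant-canonical-projection".
From mathcomp Require Import all_boot all_order all_fingroup all_algebra.
From mathcomp Require Import all_solvable generic_quotient.
From mathcomp Require Import boolp.

Set Implicit Arguments.
Unset Strict Implicit.
Unset Printing Implicit Defensive.

Import GRing.Theory.

(* All indices are 0-based: the generators a_1, ..., a_n are [a 0], ...,
   [a n.-1], and the pair (p_i, c_i) of the list is the entry i.-1 of [L].  A
   word a_1^{e_1} ... a_n^{e_n} is given by its exponent vector [e]. *)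
Notation exps n := {ffun 'I_n -> nat}.

Section Subgroups.

Variable G : groupType.
Implicit Types S A B : G -> Prop.
Local Open Scope group_scope.

Definition is_subgroup S : Prop :=
  [/\ S 1, forall x y, S x -> S y -> S (x * y) & forall x, S x -> S x^-1].

Definition gen S : G -> Prop :=
  fun x => forall B, is_subgroup B -> (forall y, S y -> B y) -> B x.

Definition prodsub A B : G -> Prop :=
  fun x => exists u v, [/\ A u, B v & x = u * v].

Definition commsub A B : G -> Prop :=
  gen (fun x => exists u v, [/\ A u, B v & x = [~ u, v]]).

Definition powsub (p : nat) A : G -> Prop :=
  gen (fun x => exists2 u, A u & x = u ^+ p).

Fixpoint pseries (p l : nat) S : G -> Prop :=
  if l is l'.+1 then
    prodsub (commsub (pseries p l' S) S) (powsub p (pseries p l' S))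
  else S.

(* [Lbase L i] is the subgroup reached after the first [i] blocks of the list,
   i.e. L_{i+1,0}(G) in 1-based numbering. *)
Fixpoint Lbase (L : seq (nat * nat)) (i : nat) : G -> Prop :=
  if i is i'.+1 then
    pseries (nth (0, 0) L i').1 (nth (0, 0) L i').2 (Lbase L i')
  else fun=> True.

Definition Lterm (L : seq (nat * nat)) (i j : nat) : G -> Prop :=
  pseries (nth (0, 0) L i).1 j (Lbase L i).

Definition Lindex (L : seq (nat * nat)) (i j : nat) : Prop :=
  i < size L /\ j <= (nth (0, 0) L i).2.

(* (i, j) is the lexicographically largest index of a term containing [x]. *)
Definition Lmax (L : seq (nat * nat)) (x : G) (i j : nat) : Prop :=
  [/\ Lindex L i j, Lterm L i j x &
      forall i' j', Lindex L i' j' -> Lterm L i' j' x ->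
        i' < i \/ i' = i /\ j' <= j].

End Subgroups.

Definition Llist (L : seq (nat * nat)) : Prop :=
  (forall pc, pc \in L -> prime pc.1 /\ 0 < pc.2) /\
  sorted (fun pc pc' => pc.1 != pc'.1) L.

Definition surj (A B : Type) (f : A -> B) : Prop := forall y, exists x, f x = y.

(* Q is isomorphic to G / S *)
Definition isom_quotient (Q G : groupType) (S : G -> Prop) : Prop :=
  exists f : {multiplicative G -> Q}, surj f /\ forall x, f x = 1%g <-> S x.

Section Words.

Variable G : groupType.
Local Open Scope group_scope.

(* the letter (l, true) stands for the inverse of the generator l *)
Definition weval (I : Type) (h : I -> G) (s : seq (I * bool)) : G :=
  \prod_(x <- s) (if x.2 then (h x.1)^-1 else h x.1).

Definition nword (n : nat) (a : 'I_n -> G) (e : exps n) : G :=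
  \prod_(l < n) a l ^+ e l.

(* the subgroup generated by the generators of (0-based) index at least l *)
Definition tailgrp (n : nat) (a : 'I_n -> G) (l : nat) : G -> Prop :=
  gen (fun x => exists2 k : 'I_n, l <= k & x = a k).

End Words.

(* (G, g) is the group given by generators indexed by I and the relations [R]:
   [g] generates G, satisfies [R], and any family satisfying [R] in any group
   is the image of [g] under a homomorphism. *)
Definition presents (I : Type) (R : forall H : groupType, (I -> H) -> Prop)
    (G : groupType) (g : I -> G) : Prop :=
  [/\ forall x, gen (fun y => exists k, y = g k) x,
      R G g &
      forall (H : groupType) (h : I -> H), R H h ->
        exists f : {multiplicative G -> H}, forall k, f (g k) = h k].

Definition fp_rels (b m : nat) (rel : 'I_m -> seq ('I_b * bool))
    (H : groupType) (h : 'I_b -> H) : Prop :=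
  forall l, weval h (rel l) = 1%g.

Section PowerConjugate.

Variable n : nat.

(* [pcq l] is q_l and, for j <= k, [pcv j k] is v_{jk}; the pair (j, k) with
   j <= k indexes the relation whose right-hand side is v_{jk}: the power
   relation of a_k if j = k, the relation for a_k^{a_j} if j < k. *)
Record pcpres := PcPres {
  pcq : 'I_n -> nat;
  pcv : 'I_n -> 'I_n -> exps n
}.

Variable D : pcpres.

Definition normal_exps (e : exps n) : Prop := forall l, e l < pcq D l.

Definition pc_wf : Prop :=
  [/\ forall l, prime (pcq D l),
      forall j k : 'I_n, j <= k -> normal_exps (pcv D j k) &
      forall j k l : 'I_n, j <= k -> l <= j -> pcv D j k l = 0].

Local Open Scope group_scope.

Definition pc_rels (H : groupType) (a : 'I_n -> H) : Prop :=
  (forall l, a l ^+ pcq D l = nword a (pcv D l l)) /\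
  (forall j k : 'I_n, (j < k)%N -> a k ^ a j = nword a (pcv D j k)).

Definition consistent (H : groupType) (a : 'I_n -> H) : Prop :=
  forall x, exists! e, normal_exps e /\ x = nword a e.

Definition refines (L : seq (nat * nat)) (H : groupType) (a : 'I_n -> H) :=
  forall i j, Lindex L i j ->
    exists2 l, (l <= n)%N & forall x : H, Lterm L i j x <-> tailgrp a l x.

Definition last_gen (e : exps n) (k : 'I_n) : Prop :=
  e k = 1%N /\ forall l : 'I_n, (k < l)%N -> e l = 0%N.

Definition generates (H : groupType) (a : 'I_n -> H) (X : {set 'I_n}) :=
  forall x, gen (fun y => exists2 k, k \in X & y = a k) x.

End PowerConjugate.

(* [lset] is the set X; for k outside X, [ldef k] is the index of the relation
   chosen as definition of a_k; for k in X, [lgen k] is the index of the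
   generator of G whose image is the definition of a_k.  The values of [ldef]
   on X and of [lgen] outside X are irrelevant. *)
Record labelling (n b : nat) := Labelling {
  lset : {set 'I_n};
  ldef : 'I_n -> 'I_n * 'I_n;
  lgen : 'I_n -> 'I_b
}.

Section Labelled.

Variables (n b : nat) (D : pcpres n) (lab : labelling n b).

(* The last clause says that the definitions are not circular: the generators
   can be ranked so that the definition of a_k expresses a_k by generators of
   smaller rank.  It excludes, e.g., taking a_2^{a_1} = a_2 as "definition" of
   a_2 in the cyclic group of order 6 on a_1^2 = a_2, a_2^3 = 1,
   a_2^{a_1} = a_2. *)
Definition labelled_pres (H : groupType) (a : 'I_n -> H) : Prop :=
  [/\ generates a (lset lab),
      forall Y : {set 'I_n}, generates a Y -> #|lset lab| <= #|Y|,
      forall k, k \notin lset lab ->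
        (ldef lab k).1 <= (ldef lab k).2 /\
        last_gen (pcv D (ldef lab k).1 (ldef lab k).2) k &
      exists rk : 'I_n -> nat, forall k, k \notin lset lab ->
        [/\ rk (ldef lab k).1 < rk k, rk (ldef lab k).2 < rk k &
            forall l, l != k -> pcv D (ldef lab k).1 (ldef lab k).2 l != 0 ->
              rk l < rk k]].

Definition labelled_epi (L : seq (nat * nat)) (H : groupType)
    (a : 'I_n -> H) (w : 'I_b -> exps n) : Prop :=
  forall k, k \in lset lab ->
    last_gen (w (lgen lab k)) k /\
    exists i j, Lmax L (a k) i j /\
      forall l, w (lgen lab k) l != 0 -> Lterm L i j (a l) -> l = k.

Definition nondef_rel (jk : 'I_n * 'I_n) : bool :=
  (jk.1 <= jk.2) && [forall k, (k \notin lset lab) ==> (ldef lab k != jk)].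

Definition nondef_gen (l : 'I_b) : bool :=
  [forall k, (k \in lset lab) ==> (lgen lab k != l)].

(* y_1, ..., y_s are indexed by the relations that are not definitions,
   z_1, ..., z_t by the generators of G whose images are not definitions. *)
Definition yidx : finType := {jk : 'I_n * 'I_n | nondef_rel jk}.
Definition zidx : finType := {l : 'I_b | nondef_gen l}.
Definition tails : finType := (yidx + zidx)%type.

(* The symbol y_u to be appended to the relation (j, k), if any. *)
Definition ytail (j k : 'I_n) : option tails := omap inl (insub (j, k)).
Definition ztail (l : 'I_b) : option tails := omap inr (insub l).

Local Open Scope group_scope.

Section Extended.

Variables (H : groupType) (h : 'I_n + tails -> H).

Definition agen (l : 'I_n) : H := h (inl l).
Definition tgen (x : tails) : H := h (inr x).
Definition otgen (o : option tails) : H := if o is Some x then tgen x else 1.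

(* [r] is the number of generators outside P.  The relations on the new
   generators are the same for the y_u and the z_v, so both are treated
   uniformly. *)
Definition ext_rels (p r : nat) : Prop :=
  [/\ forall l, agen l ^+ pcq D l = nword agen (pcv D l l) * otgen (ytail l l),
      forall j k : 'I_n, (j < k)%N ->
        agen k ^ agen j = nword agen (pcv D j k) * otgen (ytail j k),
      forall (x x' : tails) (e : exps n), normal_exps D e ->
        (forall l : 'I_n, (r <= l)%N -> e l = 0%N) ->
        [~ tgen x, tgen x' ^ nword agen e] = 1,
      forall x, tgen x ^+ p = 1 &
      forall (x : tails) (l : 'I_n), (r <= l)%N -> tgen x ^ agen l = tgen x].

(* the extended map g_l |-> g_l^sigma *)
Definition sigma (w : 'I_b -> exps n) (l : 'I_b) : H :=
  nword agen (w l) * otgen (ztail l).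

End Extended.

End Labelled.

(* The group ring R[Q], with the convolution product (and not the pointwise
   product of {ffun Q -> R}). *)
Definition groupring (R : nzRingType) (Q : finGroupType) := {ffun Q -> R}.

Section GroupRing.

Variables (R : nzRingType) (Q : finGroupType).
Local Notation A := (groupring R Q).
Local Open Scope ring_scope.

HB.instance Definition _ := GRing.Zmodule.copy A {ffun Q -> R}.

Definition gr_elt (x : Q) : A := [ffun y => (y == x)%:R].
Definition gr_mul (f g : A) : A :=
  [ffun x => \sum_y f y * g (y^-1 * x)%g].

Fact gr_mulA : associative gr_mul.
Proof.
move=> f g h; apply/ffunP=> x; rewrite !ffunE.
under eq_bigr => y _ do rewrite ffunE big_distrr /=.
under [RHS]eq_bigr => y _ do rewrite ffunE big_distrl /=.
rewrite [RHS]exchange_big /=; apply: eq_bigr => y _.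
rewrite (reindex_inj (mulgI (y^-1)%g)) /=; apply: eq_bigr => z _.
by rewrite mulrA invMg invgK -!mulgA mulKVg.
Qed.

Fact gr_mul1l : left_id (gr_elt 1%g) gr_mul.
Proof.
move=> f; apply/ffunP=> x; rewrite ffunE (bigD1 1%g) //= big1 => [|y y1].
  by rewrite ffunE eqxx mul1r invg1 mul1g addr0.
by rewrite ffunE (negPf y1) mul0r.
Qed.

Fact gr_mul1r : right_id (gr_elt 1%g) gr_mul.
Proof.
move=> f; apply/ffunP=> x; rewrite ffunE (bigD1 x) //= big1 => [|y yx].
  by rewrite ffunE mulVg eqxx mulr1 addr0.
by rewrite ffunE -eq_invg_mul invgK (negPf yx) mulr0.
Qed.

Fact gr_mulDl : left_distributive gr_mul +%R.
Proof.
move=> f g h; apply/ffunP=> x; rewrite !ffunE -big_split /=.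
by apply: eq_bigr => y _; rewrite ffunE mulrDl.
Qed.

Fact gr_mulDr : right_distributive gr_mul +%R.
Proof.
move=> f g h; apply/ffunP=> x; rewrite !ffunE -big_split /=.
by apply: eq_bigr => y _; rewrite ffunE mulrDr.
Qed.

Fact gr_1neq0 : gr_elt 1%g != 0.
Proof.
apply/eqP => /ffunP/(_ 1%g); rewrite !ffunE eqxx => /eqP.
by rewrite oner_eq0.
Qed.

HB.instance Definition _ := GRing.Zmodule_isNzRing.Build A
  gr_mulA gr_mul1l gr_mul1r gr_mulDl gr_mulDr gr_1neq0.

End GroupRing.

Section FreeModule.

Variables (A : nzRingType) (X : finType).
Local Open Scope ring_scope.

(* the free right A-module on X *)
Definition freemod := {ffun X -> A}.

HB.instance Definition _ := GRing.Zmodule.copy freemod {ffun X -> A}.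

Definition rscale (z : freemod) (c : A) : freemod := [ffun x => z x * c].

(* the A-submodule S A generated by S *)
Definition rspan (S : freemod -> Prop) : {pred freemod} := fun z =>
  `[< exists (k : nat) (s : 'I_k -> freemod) (c : 'I_k -> A),
        (forall l, S (s l)) /\ z = \sum_(l < k) rscale (s l) (c l) >].

Fact rspan_zmod_closed S : zmod_closed (rspan S).
Proof.
split=> [|u v /asboolP[k [s [c [Ss ->]]]] /asboolP[k' [s' [c' [Ss' ->]]]]].
  apply/asboolP; exists 0%N, (fun=> 0), (fun=> 0).
  by split=> [[]//|]; rewrite big_ord0.
apply/asboolP; exists (k + k')%N,
  (fun l => match split l with inl x => s x | inr y => s' y end),
  (fun l => match split l with inl x => c x | inr y => - c' y end).
split=> [l|]; first by case: split.
rewrite big_split_ord -sumrN /=; congr (_ + _); apply: eq_bigr => l _.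
  by rewrite (unsplitK (inl l)).
by rewrite (unsplitK (inr l)); apply/ffunP=> x; rewrite !ffunE mulrN.
Qed.

HB.instance Definition _ S :=
  GRing.isZmodClosed.Build freemod (rspan S) (rspan_zmod_closed S).

Definition quotmod S := Quotient.quot (rspan S).

Definition qscale S (x : quotmod S) (c : A) : quotmod S :=
  (\pi_(quotmod S) (rscale (repr x) c))%qT.

Fact pi_rscale S z c :
  qscale (\pi_(quotmod S) z)%qT c = (\pi_(quotmod S) (rscale z c))%qT.
Proof.
apply/eqP; rewrite -Quotient.idealrBE.
have: repr (\pi_(quotmod S) z)%qT - z \in rspan S.
  by rewrite Quotient.idealrBE reprK.
move=> /asboolP[k [s [d [Ss zE]]]]; apply/asboolP.
exists k, s, (fun l => d l * c); split=> //; apply/ffunP=> x.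
move/ffunP/(_ x): zE; rewrite !ffunE !sum_ffunE -mulrBl => ->.
by rewrite mulr_suml; apply: eq_bigr => l _; rewrite !ffunE mulrA.
Qed.

End FreeModule.

Section Collection.

Variables (n b p : nat) (D : pcpres n) (lab : labelling n b).
(* [Q] is K/P and [abar l] the image of a_l in K/P. *)
Variables (Q : finGroupType) (abar : 'I_n -> Q).
Local Notation A := (groupring 'F_p Q).
Local Notation T := (tails lab).
Local Notation Z := (freemod A T).
Local Open Scope ring_scope.

Inductive letter := Lgen of 'I_n | Ltail of T & A.

Definition nletters (e : exps n) : seq letter :=
  flatten [seq nseq (e l) (Lgen l) | l <- enum 'I_n].

(* right-hand side of the relation (j, k), with its y_u if it has one *)
Definition rhs (j k : 'I_n) : seq letter :=
  nletters (pcv D j k) ++ (if ytail lab j k is Some x then [:: Ltail x 1] else [::]).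

Definition tail_lt (x y : T) : bool := (enum_rank x < enum_rank y)%N.

Inductive cstep : seq letter -> seq letter -> Prop :=
| Cswap s s' x x' f f' : tail_lt x' x ->
    cstep (s ++ [:: Ltail x f; Ltail x' f'] ++ s')
          (s ++ [:: Ltail x' f'; Ltail x f] ++ s')
| Cmerge s s' x f f' :
    cstep (s ++ [:: Ltail x f; Ltail x f'] ++ s')
          (s ++ [:: Ltail x (f + f')] ++ s')
| Cmove s s' x f l :
    cstep (s ++ [:: Ltail x f; Lgen l] ++ s')
          (s ++ [:: Lgen l; Ltail x (f * gr_elt 'F_p (abar l))] ++ s')
| Cpower s s' l :
    cstep (s ++ nseq (pcq D l) (Lgen l) ++ s') (s ++ rhs l l ++ s')
| Cconj s s' (l j : 'I_n) : (l < j)%N ->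
    cstep (s ++ [:: Lgen j; Lgen l] ++ s') (s ++ Lgen l :: rhs l j ++ s').

(* [s] is the generalised normal word with a-part [e] and tail part [f];
   a symbol that does not occur in [s] has exponent 0. *)
Definition gnormal (s : seq letter) (e : exps n) (f : Z) : Prop :=
  exists ys : seq (T * A),
    [/\ normal_exps D e, sorted tail_lt [seq y.1 | y <- ys],
        s = nletters e ++ [seq Ltail y.1 y.2 | y <- ys] &
        f = [ffun x => \sum_(y <- ys | y.1 == x) y.2]].

Definition collects (s : seq letter) (e : exps n) (f : Z) (c : seq letter) :=
  clos_refl_trans _ cstep s c /\ gnormal c e f.

(* [(s, t, s')] is the bracketed word (s (t) s'). *)
Definition bword := (seq letter * seq letter * seq letter)%type.

Definition bcollects (u : bword) (e : exps n) (f : Z) : Prop :=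
  exists e' f' c' c, collects u.1.2 e' f' c' /\ collects (u.1.1 ++ c' ++ u.2) e f c.

(* [ctest u u'] : (u u'^-1) is one of the consistency test words. *)
Inductive ctest : bword -> bword -> Prop :=
| Ctest_conj (i j k : 'I_n) : (i < j)%N -> (j < k)%N ->
    ctest ([::], [:: Lgen k; Lgen j], [:: Lgen i])
          ([:: Lgen k], [:: Lgen j; Lgen i], [::])
| Ctest_powl (j k : 'I_n) : (j < k)%N ->
    ctest ([::], nseq (pcq D k) (Lgen k), [:: Lgen j])
          (nseq (pcq D k).-1 (Lgen k), [:: Lgen k; Lgen j], [::])
| Ctest_powr (i j : 'I_n) : (i < j)%N ->
    ctest ([::], [:: Lgen j; Lgen i], nseq (pcq D i).-1 (Lgen i))
          ([:: Lgen j], nseq (pcq D i) (Lgen i), [::])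
| Ctest_pow (i : 'I_n) :
    ctest ([::], nseq (pcq D i) (Lgen i), [:: Lgen i])
          ([:: Lgen i], nseq (pcq D i) (Lgen i), [::]).

Definition ctest_value (u u' : bword) (z : Z) : Prop :=
  exists e f f', [/\ bcollects u e f, bcollects u' e f' &
    z = rscale (f - f') (gr_elt 'F_p (nword abar e)^-1%g)].

(* Collection is not deterministic, so each test word may be collected in
   several ways; S may consist of the outcomes of any choices. *)
Definition ctest_set (S : Z -> Prop) : Prop :=
  (forall z, S z -> exists u u', ctest u u' /\ ctest_value u u' z) /\
  (forall u u', ctest u u' -> exists2 z, S z & ctest_value u u' z).

(* [sec] represents the elements of K/P by normal words in a_1, ..., a_r. *)
Definition transversal_words (r : nat) (sec : Q -> exps n) : Prop :=
  forall c, [/\ normal_exps D (sec c), forall l : 'I_n, (r <= l)%N -> sec c l = 0%N &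
    nword abar (sec c) = c].

(* The element of the extended group denoted by z, where a symbol y^f with
   f = sum_c f_c c stands for the product of the (y^c)^{f_c}. *)
Definition mod_eval (sec : Q -> exps n) (H : groupType) (h : 'I_n + T -> H)
    (z : Z) : H :=
  (\prod_(x : T) \prod_(c : Q)
     (tgen h x ^ nword (agen h) (sec c)) ^+ (z x c : nat))%g.

(* As for the tests: the elements of Z representing the values of the relators
   in the extended group, for any choices of such representatives. *)
Definition relator_set (m : nat) (rel : 'I_m -> seq ('I_b * bool))
    (w : 'I_b -> exps n) (sec : Q -> exps n) (H : groupType)
    (h : 'I_n + T -> H) (S : Z -> Prop) : Prop :=
  (forall z, S z ->
     exists l, weval (sigma h w) (rel l) = mod_eval sec h z) /\
  (forall l, exists2 z, S z & weval (sigma h w) (rel l) = mod_eval sec h z).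

End Collection.

(* The action of F_p Q on an element x of a kernel on which H acts by
   conjugation through Q, for representatives [s] in H of the elements of Q. *)
Definition conj_act (p : nat) (Q : finGroupType) (H : groupType) (s : Q -> H)
    (x : H) (f : groupring 'F_p Q) : H :=
  (\prod_(c : Q) (x ^ s c) ^+ (f c : nat))%g.

(* Main.v *)
Require Import Defs.
From HB Require Import structures.
From Stdlib Require Import Relation_Operators.
From mathcomp Require Import all_boot all_fingroup all_algebra all_solvable.
From mathcomp Require Import generic_quotient boolp zify.

(** Both directions only use the universal property of the extended covering
group, never its structure.

In H the generators a_l of K can be lifted one after the other so that the
definitions hold exactly; the terms of the L-series being normal, the
definitions are not circular.  The other relations and the images of the
generators of G then hold up to factors in N, the values of y_u and z_v under a
linear map F : Z -> N.  Collecting words in H shows that F kills T and U and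
that F is onto N.

Conversely, put M = Z / (T u U).  The tests in T are the critical pairs of the
collection process with tails in M; as collection terminates, it is confluent,
so collected words form a group E that extends K by M.  The elements of U being
killed in M, G maps to E, and this map kills L_{i,j+1}(G), hence factors
through H.  As the definitions determine the lifts of the a_l, the map from H
to E takes F z to the class of z, so that F vanishes on no further element. *)

Set Implicit Arguments.
Unset Strict Implicit.
Unset Printing Implicit Defensive.

Import GRing.Theory.

(* mathcomp.solvable has a [pseries] of its own. *)
Local Notation pseries := Defs.pseries.

(** The hypotheses give K and H only up to some isomorphism with a quotient of G. That [theta] and
    [tau] themselves have the expected kernels follows from the Hopfian property of finite groups.
    For H, finiteness has to be proved: once F is known to be onto N, every element of H comes from
    one of the finitely many pairs of an element of K and an element of Z.

    Collection is not deterministic, and the value of a relator in the extended group may have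
    several representatives in Z. Tails are therefore compared only after a linear map from Z to a
    module in which all outcomes agree: in N because the group H already exists, in M because T
    vanishes there. For this reason collection is studied with tails in an arbitrary module, and H
    and E are two instances of the same structure [realizes]. Relators are evaluated in both by
    mapping the extended group there. *)

Section GroupMorphisms.

Variables (G H : groupType) (f : {multiplicative G -> H}).
Local Open Scope group_scope.

(* [gmulf1] and the like expect a [UMagmaMorphism], a structure that
   [{multiplicative _ -> _}] does not provide. *)
Lemma mor1 : f 1 = 1.
Proof. by apply: (mulgI (f 1)); rewrite -gmulfM !mulg1. Qed.

Lemma morX n : {morph f : x / x ^+ n}.
Proof. by move=> x; elim: n => [|n IHn]; rewrite ?mor1 // !expgS gmulfM IHn. Qed.

Lemma mor_prod (I : Type) (r : seq I) (P : pred I) E :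
  f (\prod_(i <- r | P i) E i) = \prod_(i <- r | P i) f (E i).
Proof. by elim/big_rec2: _ => [|i y x _ <-]; rewrite ?mor1 ?gmulfM. Qed.

Lemma morV : {morph f : x / x^-1}.
Proof. by move=> x; apply: (mulgI (f x)); rewrite -gmulfM !mulgV mor1. Qed.

Lemma morF : {morph f : x y / x * y^-1}.
Proof. by move=> x y; rewrite gmulfM morV. Qed.

Lemma morJ : {morph f : x y / x ^ y}.
Proof. by move=> x y; rewrite !conjgE !gmulfM morV. Qed.

Lemma morR : {morph f : x y / [~ x, y]}.
Proof. by move=> x y; rewrite !commgEl gmulfM morV morJ. Qed.

End GroupMorphisms.

(** * Subgroups given by predicates *)

Section SubgroupTheory.

Variable G : groupType.
Implicit Types (A B S : G -> Prop).
Local Open Scope group_scope.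

Definition conj_closed S := forall x y, S x -> S (x ^ y).

Lemma gen_incl S x : S x -> gen S x.
Proof. by move=> Sx B _; apply. Qed.

Lemma gen_subgroup S : is_subgroup (gen S).
Proof.
split=> [B [B1 _ _] _ //|x y Gx Gy B sB SB|x Gx B sB SB].
  by case: (sB) => _ BM _; apply: BM; [apply: Gx | apply: Gy].
by case: (sB) => _ _ BV; apply: BV; apply: Gx.
Qed.

Lemma gen_conj_closed S : conj_closed S -> conj_closed (gen S).
Proof.
move=> nS x y Gx; have [g1 gM gV] := gen_subgroup S.
apply: (Gx (fun x => gen S (x ^ y))) => [|z Sz]; last by apply: gen_incl; apply: nS.
split=> [|u v Su Sv|u Su]; first by rewrite conj1g.
  by rewrite conjMg; apply: gM.
by rewrite conjVg; apply: gV.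
Qed.

Lemma subgroupX S n x : is_subgroup S -> S x -> S (x ^+ n).
Proof.
by move=> [S1 SM _] Sx; elim: n => // n IHn; rewrite expgS; apply: SM.
Qed.

Lemma commsub_conj_closed A S :
  conj_closed A -> conj_closed S -> conj_closed (commsub A S).
Proof.
move=> nA nS; apply: gen_conj_closed => _ y [u [v [Au Sv ->]]].
by exists (u ^ y), (v ^ y); rewrite conjRg; split; [apply: nA|apply: nS|].
Qed.

Lemma powsub_conj_closed p A : conj_closed A -> conj_closed (powsub p A).
Proof.
move=> nA; apply: gen_conj_closed => _ y [u Au ->].
by exists (u ^ y); rewrite ?conjXg //; apply: nA.
Qed.

Lemma prodsub_subgroup A B : is_subgroup A -> is_subgroup B -> conj_closed A ->
  is_subgroup (prodsub A B).
Proof.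
move=> [A1 AM AV] [B1 BM BV] nA; split.
- by exists 1, 1; rewrite mulg1.
- move=> _ _ [a [b [Aa Bb ->]]] [a' [b' [Aa' Bb' ->]]].
  exists (a * a' ^ b^-1), (b * b'); split; [|exact: BM|].
    by apply: AM => //; apply: nA.
  by rewrite conjgE invgK !mulgA mulgVK.
- move=> _ [a [b [Aa Bb ->]]]; exists (a^-1 ^ b), b^-1.
  split; [by apply: nA; apply: AV|exact: BV|].
  by rewrite conjgE !mulgA mulgK invgM.
Qed.

Lemma pseries_normal p l S : is_subgroup S -> conj_closed S ->
  is_subgroup (pseries p l S) /\ conj_closed (pseries p l S).
Proof.
move=> sS nS; elim: l => //= l [sA nA]; split.
  apply: prodsub_subgroup; try exact: gen_subgroup.
  exact: commsub_conj_closed.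
move=> _ y [u [v [Au Bv ->]]]; exists (u ^ y), (v ^ y); split.
- exact: commsub_conj_closed.
- exact: powsub_conj_closed.
- by rewrite conjMg.
Qed.

Lemma pseriesS_sub p l S : is_subgroup S -> conj_closed S ->
  forall x, pseries p l.+1 S x -> pseries p l S x.
Proof.
move=> sS nS _ [u [v [Au Bv ->]]]; have [sA nA] := pseries_normal p l sS nS.
case: (sA) => _ AM AV; apply: (AM).
  by apply: Au => // _ [x [y [Ax Sy ->]]]; apply: AM; [apply: AV | apply: nA].
by apply: Bv => // _ [x Ax ->]; apply: subgroupX.
Qed.

Lemma pseries_sub p l S : is_subgroup S -> conj_closed S ->
  forall x, pseries p l S x -> S x.
Proof. by move=> sS nS; elim: l => // l IHl x /pseriesS_sub-/(_ sS nS)/IHl. Qed.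

Lemma Lbase_normal L i : is_subgroup (@Lbase G L i) /\ conj_closed (@Lbase G L i).
Proof. by elim: i => [|i [sB nB]] /=; [|apply: pseries_normal]. Qed.

Lemma Lterm_subgroup L i j : is_subgroup (@Lterm G L i j).
Proof. have [sB nB] := Lbase_normal L i.
by case: (pseries_normal (nth (0, 0) L i).1 j sB nB). Qed.

Lemma Lterm_conj L i j : conj_closed (@Lterm G L i j).
Proof.
have [sB nB] := Lbase_normal L i.
by case: (pseries_normal (nth (0, 0) L i).1 j sB nB).
Qed.

Lemma Lterm_base L i j x : @Lterm G L i j x -> @Lterm G L i 0 x.
Proof. by have [sB nB] := Lbase_normal L i; apply: pseries_sub. Qed.

Lemma LtermS_comm L i j u v :
  @Lterm G L i j u -> @Lterm G L i 0 v -> @Lterm G L i j.+1 [~ u, v].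
Proof.
move=> Lu Lv; have [g1 _ _] := gen_subgroup (fun x : G =>
  exists2 u, pseries (nth (0, 0) L i).1 j (Lbase L i) u
           & x = u ^+ (nth (0, 0) L i).1).
by exists [~ u, v], 1; rewrite mulg1; split=> //; apply: gen_incl; exists u, v.
Qed.

Lemma LtermS_pow L i j u :
  @Lterm G L i j u -> @Lterm G L i j.+1 (u ^+ (nth (0, 0) L i).1).
Proof.
move=> Lu; exists 1, (u ^+ (nth (0, 0) L i).1); rewrite mul1g; split=> //.
  by have [] := gen_subgroup (fun x : G =>
    exists u v, [/\ Lterm L i j u, Lbase L i v & x = [~ u, v]]).
by apply: gen_incl; exists u.
Qed.

End SubgroupTheory.

(** * Behaviour of the series under homomorphisms *)

Section Morphisms.

Variables (G H : groupType) (f : {multiplicative G -> H}).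
Local Open Scope group_scope.

Lemma gen_mor (S : G -> Prop) (S' : H -> Prop) x :
  (forall y, S y -> S' (f y)) -> gen S x -> gen S' (f x).
Proof.
move=> SS' Gx; have [g1 gM gV] := gen_subgroup S'.
apply: (Gx (fun x => gen S' (f x))) => [|y /SS'/gen_incl //].
split=> [|u v|u]; first by rewrite mor1.
  by rewrite gmulfM; apply: gM.
by rewrite morV; apply: gV.
Qed.

Lemma gen_mor_onto (S : G -> Prop) (S' : H -> Prop) y :
  (forall y, S' y -> exists2 x, S x & f x = y) -> gen S' y ->
  exists2 x, gen S x & f x = y.
Proof.
move=> SS' Gy; have [g1 gM gV] := gen_subgroup S.
apply: (Gy (fun y => exists2 x, gen S x & f x = y)) => [|z /SS'[x Sx <-]].
  split=> [|_ _ [u Su <-] [v Sv <-]|_ [u Su <-]].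
  - by exists 1; rewrite ?mor1.
  - by exists (u * v); rewrite ?gmulfM //; apply: gM.
  - by exists u^-1; rewrite ?morV //; apply: gV.
by exists x => //; apply: gen_incl.
Qed.

Lemma pseries_mor p l (S : G -> Prop) (S' : H -> Prop) :
  (forall x, S x -> S' (f x)) ->
  forall x, pseries p l S x -> pseries p l S' (f x).
Proof.
move=> SS'; elim: l => //= l IHl _ [u [v [Au Bv ->]]].
exists (f u), (f v); rewrite gmulfM; split=> //.
  apply: gen_mor Au => _ [a [b [Aa Sb ->]]].
  by exists (f a), (f b); rewrite morR; split; auto.
by apply: gen_mor Bv => _ [a Aa ->]; exists (f a); rewrite ?morX; auto.
Qed.

Lemma pseries_mor_onto p l (S : G -> Prop) (S' : H -> Prop) :
  (forall y, S' y -> exists2 x, S x & f x = y) ->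
  forall y, pseries p l S' y -> exists2 x, pseries p l S x & f x = y.
Proof.
move=> SS'; elim: l => //= l IHl _ [u [v [Au Bv ->]]].
have [u' Au' <-] : exists2 x, commsub (pseries p l S) S x & f x = u.
  apply: gen_mor_onto Au => _ [a [b [/IHl[a' Aa' <-] /SS'[b' Sb' <-] ->]]].
  by exists [~ a', b']; rewrite ?morR //; exists a', b'.
have [v' Bv' <-] : exists2 x, powsub p (pseries p l S) x & f x = v.
  apply: gen_mor_onto Bv => _ [a /IHl[a' Aa' <-] ->].
  by exists (a' ^+ p); rewrite ?morX //; exists a'.
by exists (u' * v'); rewrite ?gmulfM //; exists u', v'.
Qed.

Lemma Lterm_mor L i j x : Lterm L i j x -> Lterm L i j (f x).
Proof.
by apply: pseries_mor => {}x; elim: i x => //= i IHi x; apply: pseries_mor.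
Qed.

Lemma Lterm_mor_onto L i j y : surj f ->
  Lterm L i j y -> exists2 x, Lterm L i j x & f x = y.
Proof.
move=> sf; apply: pseries_mor_onto => {}y; elim: i y => [y _|i IHi y] /=.
  by have [x <-] := sf y; exists x.
exact: pseries_mor_onto.
Qed.

End Morphisms.

(** A surjection maps each term onto the corresponding term, so the term of [Q] is the image of the
    kernel. *)
Lemma isom_quotient_Lterm (Q G : groupType) L i j :
  isom_quotient Q (@Lterm G L i j) -> forall x : Q, Lterm L i j x -> x = 1%g.
Proof. by move=> [f [sf kf]] x /(Lterm_mor_onto sf)[y /kf fy <-]. Qed.

(* Finite groups are Hopfian. *)
Lemma epi_Lterm_kernel (Q G : groupType) (C : finType) (e : C -> Q) L i j
    (f : {multiplicative G -> Q}) :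
  surj e -> isom_quotient Q (@Lterm G L i j) -> surj f ->
  forall x, f x = 1%g <-> Lterm L i j x.
Proof.
move=> se isoQ sf x; have LQ1 := isom_quotient_Lterm isoQ.
split=> [fx1|/(Lterm_mor f)/LQ1 //]; have [f0 [sf0 kf0]] := isoQ.
have /choice[s0 s0K] := sf0.
(* [al] is the endomorphism of [Q] that [f] induces through [f0], because the kernel of [f0] lies in
   that of [f]. It is onto because [f] is, hence injective by counting. *)
pose al y := f (s0 y).
have al_f0 y : al (f0 y) = f y.
  apply: divg1_eq; rewrite -morF; apply/LQ1/Lterm_mor/kf0.
  by rewrite morF s0K mulgV.
pose s := undup [seq e c | c <- enum C].
have s_all q : q \in s.
  by have [c <-] := se q; rewrite mem_undup map_f ?mem_enum.
have us : uniq (map al s).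
  apply: (@leq_size_uniq _ s); rewrite ?undup_uniq ?size_map // => q _.
  have [y <-] := sf q; rewrite -al_f0; exact: map_f.
have al_inj y z : al y = al z -> y = z.
  move=> eq_al; have sz := s_all z; have sy := s_all y.
  suff eq_ind: index y s = index z s.
    by rewrite -(nth_index 1%g sy) eq_ind nth_index.
  apply/eqP; rewrite -(nth_uniq (al 1%g) _ _ us) ?size_map ?index_mem //.
  by rewrite !(nth_map 1%g) ?index_mem // !nth_index // eq_al.
by apply: (proj1 (kf0 x)); apply: al_inj; rewrite al_f0 fx1 -(mor1 f0) al_f0 !mor1.
Qed.

(** * Termination of collection *)

(* The letter a_l is interpreted as the function [phi B (n - l)], a word as the
   composition of its letters from left to right; [phi B d.+1] outgrows any
   [B]-fold composition of the functions [phi B k] with [k <= d]. *)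
Fixpoint phi (B d x : nat) : nat :=
  if d is d'.+1 then iter x.+1 (fun y => (iter B (phi B d') y).+1) x else x.+1.

Section IterMono.

Variable g : nat -> nat.
Hypotheses (g_lt : forall x, x < g x) (g_mono : forall x y, x < y -> g x < g y).

Lemma iter_lt_mono k x y : x < y -> iter k g x < iter k g y.
Proof. by move=> lt_xy; elim: k => //= k IHk; apply: g_mono. Qed.

Lemma iter_le_mono k x y : x <= y -> iter k g x <= iter k g y.
Proof.
by rewrite leq_eqVlt => /predU1P[-> //|/(iter_lt_mono k)/ltnW].
Qed.

Lemma iter_infl k x : x <= iter k g x.
Proof. by elim: k => //= k IHk; apply: leq_trans IHk (ltnW (g_lt _)). Qed.

Lemma iter_leq k k' x : k <= k' -> iter k g x <= iter k' g x.
Proof. by move/subnK <-; rewrite iterD iter_infl. Qed.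

End IterMono.

Lemma phi_props B d :
  (forall x, x < phi B d x) /\ (forall x y, x < y -> phi B d x < phi B d y).
Proof.
elim: d => [|d [phi_lt phi_mono]]; first by split.
have G_lt x : x < (iter B (phi B d) x).+1 by rewrite ltnS iter_infl.
have G_mono x y : x < y -> (iter B (phi B d) x).+1 < (iter B (phi B d) y).+1.
  by move=> lt_xy; rewrite ltnS iter_lt_mono.
split=> [x|x y lt_xy] /=.
  rewrite ltnS; apply: leq_trans (iter_infl phi_lt B _).
  exact: (iter_infl G_lt).
rewrite ltnS; apply: iter_lt_mono => //; apply: leq_trans (iter_lt_mono G_mono x lt_xy) _.
by apply: iter_leq => //; apply: ltnW.
Qed.

Lemma phi_gt B d x : x < phi B d x. Proof. by have [] := phi_props B d. Qed.

Lemma phi_mono B d x y : x < y -> phi B d x < phi B d y.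
Proof. by have [_] := phi_props B d; apply. Qed.

Lemma phi_mono_le B d x y : x <= y -> phi B d x <= phi B d y.
Proof. by rewrite leq_eqVlt => /predU1P[-> //|/(phi_mono B d)/ltnW]. Qed.

Lemma phiS_iter B d x : iter B (phi B d) x < phi B d.+1 x.
Proof.
rewrite /= ltnS; apply: iter_le_mono; first exact: phi_mono.
by apply: iter_infl => y; rewrite ltnS; apply: iter_infl; apply: phi_gt.
Qed.

(** Raising the argument from [x] to [y] adds at least one round of [G], which absorbs the [B] extra
    applications. This is why the number of rounds in [phi] depends on the argument. *)
Lemma phiS_lt B d x y : x < y -> iter B (phi B d) (phi B d.+1 x) < phi B d.+1 y.
Proof.
set G := fun y => (iter B (phi B d) y).+1; move=> lt_xy.
have G_lt z : z < G z by rewrite ltnS; apply: iter_infl; apply: phi_gt.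
have G_mono z z' : z < z' -> G z < G z'.
  by move=> ?; rewrite ltnS; apply: iter_lt_mono => //; apply: phi_mono.
rewrite -[X in X < _]/(G (iter x.+1 G x)).-1 /= -/G -[X in X < _]/(G (iter x.+1 G x)).-1.
apply: leq_trans (_ : G (iter x.+1 G x) <= _); first by [].
rewrite -iterS; apply: leq_trans (iter_leq G_lt _ (_ : x.+2 <= y.+1)) => //.
exact/iter_le_mono/ltnW.
Qed.

Lemma phi_leq B d d' x : 0 < B -> d <= d' -> phi B d x <= phi B d' x.
Proof.
move=> B0 /subnK <-; elim: (d' - d) => [//|k IHk]; rewrite addSn.
apply: leq_trans (ltnW (phiS_iter B (k + d) x)).
apply: leq_trans IHk _; rewrite -(prednK B0) iterSr.
exact/iter_infl/phi_gt.
Qed.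

(** * Words in the generators *)

Section NormalWords.

Variable n : nat.
Implicit Types (e : exps n) (w : seq 'I_n).

Definition nlet e : seq 'I_n := flatten [seq nseq (e l) l | l <- enum 'I_n].

Definition wordev (X : groupType) (al : 'I_n -> X) (w : seq 'I_n) : X :=
  (\prod_(l <- w) al l)%g.

Lemma wordev_cat (X : groupType) (al : 'I_n -> X) w w' :
  wordev al (w ++ w') = (wordev al w * wordev al w')%g.
Proof. exact: big_cat. Qed.

Lemma wordev_cons (X : groupType) (al : 'I_n -> X) l w :
  wordev al (l :: w) = (al l * wordev al w)%g.
Proof. exact: big_cons. Qed.

Lemma wordev_nil (X : groupType) (al : 'I_n -> X) : wordev al [::] = 1%g.
Proof. exact: big_nil. Qed.

Lemma wordev1 (X : groupType) (al : 'I_n -> X) l : wordev al [:: l] = al l.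
Proof. by rewrite wordev_cons wordev_nil mulg1. Qed.

Lemma wordev_nseq (X : groupType) (al : 'I_n -> X) k l :
  wordev al (nseq k l) = (al l ^+ k)%g.
Proof. by elim: k => [|k IHk] /=; rewrite ?wordev_nil ?wordev_cons ?IHk ?expgS. Qed.

Lemma wordev_nlet (X : groupType) (al : 'I_n -> X) e :
  wordev al (nlet e) = nword al e.
Proof.
have ->: nword al e = (\prod_(l <- enum 'I_n) al l ^+ e l)%g.
  by rewrite /nword [index_enum _]unlock -enumT.
rewrite /nlet; elim: (enum _) => [|l s IHs] /=.
  by rewrite wordev_nil big_nil.
by rewrite wordev_cat wordev_nseq big_cons IHs.
Qed.

Lemma mor_wordev (X Y : groupType) (f : {multiplicative X -> Y})
    (al : 'I_n -> X) w : f (wordev al w) = wordev (f \o al) w.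
Proof. exact: mor_prod. Qed.

Lemma mor_nword (X Y : groupType) (f : {multiplicative X -> Y})
    (al : 'I_n -> X) e : f (nword al e) = nword (f \o al) e.
Proof. by rewrite -!wordev_nlet mor_wordev. Qed.

Lemma count_nlet e l : count_mem l (nlet e) = e l.
Proof.
rewrite count_flatten sumnE !big_map -enumT big_enum /= (bigD1 l) //= big1 => [|k kl].
  by rewrite count_nseq /= eqxx mul1n addn0.
by rewrite count_nseq /= (negPf kl).
Qed.

Lemma mem_nlet e l : (l \in nlet e) = (e l != 0).
Proof. by rewrite -has_pred1 has_count count_nlet lt0n. Qed.

Definition leq_ord_rel : rel 'I_n := fun k l => k <= l.

Lemma leq_ord_trans : transitive leq_ord_rel.
Proof. by move=> x y z; apply: leq_trans. Qed.

Lemma sorted_nlet e : sorted leq_ord_rel (nlet e).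
Proof.
rewrite (sorted_pairwise leq_ord_trans).
have: pairwise (fun k l : 'I_n => k < l) (enum 'I_n).
  rewrite -(@pairwise_map _ _ (@nat_of_ord n) ltn) val_enum_ord.
  by rewrite -(sorted_pairwise ltn_trans) iota_ltn_sorted.
rewrite /nlet; elim: (enum _) => //= l s IHs /andP[/allP ls /IHs ps].
rewrite pairwise_cat ps andbT; apply/andP; split.
  apply/allrelP=> x y; rewrite mem_nseq => /andP[_ /eqP->].
  by case/flatten_mapP=> k /ls lk; rewrite mem_nseq => /andP[_ /eqP->]; apply: ltnW.
elim: (e l) => //= k ->; rewrite andbT; apply/allP=> x.
by rewrite mem_nseq => /andP[_ /eqP->]; rewrite /leq_ord_rel.
Qed.

Lemma unsorted_split w : ~~ sorted leq_ord_rel w ->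
  exists x1 (j l : 'I_n) x2, w = x1 ++ [:: j; l] ++ x2 /\ l < j.
Proof.
elim: w => //= j [|l w] IHw //=; rewrite negb_and => /orP[|/IHw].
  by rewrite /leq_ord_rel -ltnNge => lj; exists [::], j, l, w.
by move=> [x1 [j' [l' [x2 [-> lj]]]]]; exists (j :: x1), j', l', x2.
Qed.

Lemma nlet_count w : sorted leq_ord_rel w ->
  w = nlet [ffun l => count_mem l w].
Proof.
move=> sw; apply: (sorted_eq leq_ord_trans) => //.
- by move=> x y /anti_leq/val_inj.
- exact: sorted_nlet.
- by apply/allP=> l _ /=; rewrite count_nlet ffunE.
Qed.

Lemma nlet_infix e l : exists x1 x2, nlet e = x1 ++ nseq (e l) l ++ x2.
Proof.
rewrite /nlet; have := mem_enum 'I_n l; rewrite inE => l_in.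
case/splitPr: l_in => s1 s2; rewrite map_cat flatten_cat /=.
by eexists; eexists.
Qed.

Lemma nword_support (X : groupType) (al be : 'I_n -> X) e :
  (forall l, e l != 0 -> al l = be l) -> nword al e = nword be e.
Proof.
move=> eq_ab; apply: eq_bigr => l _.
by case: (eqVneq (e l) 0) => [-> //|/eq_ab ->].
Qed.

Definition exps0 : exps n := [ffun=> 0].

Lemma nlet0 : nlet exps0 = [::].
Proof.
apply/nilP; rewrite /nilp -leqn0 leqNgt; apply/negP.
case E: (nlet exps0) => [//|l w] _.
by have := mem_nlet exps0 l; rewrite E ffunE inE eqxx.
Qed.

Definition exps1 (l : 'I_n) : exps n := [ffun k => nat_of_bool (k == l)].

Lemma nlet1 l : nlet (exps1 l) = [:: l].
Proof.
rewrite [RHS]nlet_count //; congr nlet; apply/ffunP=> k.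
by rewrite !ffunE /= addn0 eq_sym.
Qed.

(** Splitting off the last factor is what allows a definition to be solved for the generator it
    defines. *)
Lemma nword_last (X : groupType) (al : 'I_n -> X) e k : last_gen e k ->
  nword al e = (nword al [ffun l => if l == k then 0 else e l] * al k)%g.
Proof.
move=> [ek1 ek0]; rewrite -!wordev_nlet -[al k]wordev1 -wordev_cat.
congr wordev; apply: (sorted_eq leq_ord_trans).
- by move=> x y /anti_leq/val_inj.
- exact: sorted_nlet.
- rewrite (sorted_pairwise leq_ord_trans) pairwise_cat /=.
  rewrite -(sorted_pairwise leq_ord_trans) sorted_nlet !andbT.
  apply/allrelP=> x y; rewrite inE mem_nlet ffunE => xk /eqP->.
  case: (x =P k) xk => // _; apply: contraR; rewrite /leq_ord_rel -ltnNge.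
  by move/ek0/eqP.
- apply/allP=> l _ /=; rewrite count_cat !count_nlet /= ffunE addn0 [k == l]eq_sym.
  by case: (eqVneq l k) => [->|_]; rewrite ?ek1 ?addn0.
Qed.

End NormalWords.

Lemma nseq_cat_cons (T : Type) k (x : T) s :
  nseq k x ++ x :: s = x :: nseq k x ++ s.
Proof. by elim: k => //= k ->. Qed.

(** * Collection of words with tails in a module *)

Record is_act (K : groupType) (M : zmodType) (act : M -> K -> M) : Prop := IsAct {
  ractD : forall m m' x, act (m + m')%R x = (act m x + act m' x)%R;
  ract1 : forall m, act m 1%g = m;
  ractM : forall m x y, act m (x * y)%g = act (act m x) y
}.

Section ActTheory.

Variables (K : groupType) (M : zmodType) (act : M -> K -> M) (hact : is_act act).

Lemma ract0 x : act 0%R x = 0%R.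
Proof. by apply: (addrI (act 0%R x)); rewrite -(ractD hact) !addr0. Qed.

End ActTheory.

Section Reduction.

Variables (n : nat) (D : pcpres n) (K : groupType) (a : 'I_n -> K).
Hypotheses (hD : pc_wf D) (ha : pc_rels D a).
Variables (M : zmodType) (act : M -> K -> M) (hact : is_act act).
(* [t j k] is the tail of the relation (j, k). *)
Variable t : 'I_n -> 'I_n -> M.

Local Notation ev := (wordev a).
Local Notation q := (pcq D).
Local Notation vw j k := (nlet (pcv D j k)).

Inductive rule : seq 'I_n -> seq 'I_n -> M -> Prop :=
| Rpow l : rule (nseq (q l) l) (vw l l) (t l l)
| Rconj (l j : 'I_n) : l < j -> rule [:: j; l] (l :: vw l j) (t l j).

(* [red w w' m]: w can be collected to w' times the tail m. *)
Inductive red : seq 'I_n -> seq 'I_n -> M -> Prop :=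
| Red0 w : red w w 0%R
| RedS x1 L R s x2 w m : rule L R s -> red (x1 ++ R ++ x2) w m ->
    red (x1 ++ L ++ x2) w (act s (ev x2) + m)%R.

Lemma q_gt1 l : 1 < q l.
Proof. by have [pq _ _] := hD; apply: prime_gt1. Qed.

Lemma q_gt0 l : 0 < q l. Proof. exact/ltnW/q_gt1. Qed.

Lemma vw_gt (j k l : 'I_n) : j <= k -> l \in vw j k -> j < l.
Proof.
by have [_ _ v0] := hD; move=> jk; rewrite mem_nlet ltnNge; apply: contra => /(v0 _ _ _ jk)->.
Qed.

Lemma rule_ev L R s : rule L R s -> ev L = ev R.
Proof.
have [apow aconj] := ha; case=> [l|l j lj].
  by rewrite wordev_nseq apow wordev_nlet.
rewrite !wordev_cons wordev_nil mulg1 wordev_nlet -aconj //.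
by rewrite conjgE mulVKg.
Qed.

Lemma red_ev w w' m : red w w' m -> ev w = ev w'.
Proof. by elim=> // x1 L R s x2 {}w {}m /rule_ev e _ <-; rewrite !wordev_cat e. Qed.

Lemma red_trans w w' w'' m m' : red w w' m -> red w' w'' m' -> red w w'' (m + m')%R.
Proof.
elim=> [{}w|x1 L R s x2 {}w {}m r _ IH] r'; first by rewrite add0r.
by rewrite -addrA; apply: (RedS r); apply: IH.
Qed.

Lemma red_ctx z1 z2 w w' m : red w w' m ->
  red (z1 ++ w ++ z2) (z1 ++ w' ++ z2) (act m (ev z2)).
Proof.
elim=> [{}w|x1 L R s x2 {}w {}m r _ IH]; first by rewrite (ract0 hact); apply: Red0.
rewrite (ractD hact) -(ractM hact) -wordev_cat -!catA (catA z1).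
by apply: (RedS r); rewrite -!catA in IH *.
Qed.

Lemma red_catl z w w' m : red w w' m -> red (z ++ w) (z ++ w') m.
Proof.
by move=> /(red_ctx z [::]); rewrite wordev_nil (ract1 hact) !cats0.
Qed.

Lemma red_catr z w w' m : red w w' m -> red (w ++ z) (w' ++ z) (act m (ev z)).
Proof. exact: (@red_ctx [::]). Qed.

(** The letters that a rule introduces are larger than one of those that it consumes. *)
Lemma red_geq (l : nat) w w' m : red w w' m ->
  (forall k, k \in w -> l <= k) -> forall k, k \in w' -> l <= k.
Proof.
elim=> // x1 L R s x2 {}w {}m r _ IH hl; apply: IH => k.
have hL k' : k' \in L -> l <= k' by move=> kL; apply: hl; rewrite !mem_cat kL orbT.
rewrite !mem_cat => /or3P[kx|kR|kx]; try by apply: hl; rewrite !mem_cat kx ?orbT.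
case: r hL kR => [j|j i ji] hL.
  have lj : l <= j by apply: hL; rewrite mem_nseq q_gt0 eqxx.
  by move/(vw_gt (leqnn j))/ltnW; apply: leq_trans.
have lj : l <= j by apply: hL; rewrite !inE eqxx orbT.
rewrite inE => /predU1P[-> //|/(vw_gt (ltnW ji))/ltnW]; exact: leq_trans.
Qed.

Lemma rule_normal e L R s x1 x2 :
  normal_exps D e -> nlet e = x1 ++ L ++ x2 -> rule L R s -> False.
Proof.
move=> he eE r; case: r eE => [l|l j lj] eE.
  have := he l; rewrite -count_nlet eE !count_cat count_nseq /= eqxx mul1n.
  by rewrite addnCA ltnNge leq_addr.
have := sorted_nlet e; rewrite (sorted_pairwise (@leq_ord_trans n)) eE.
rewrite !pairwise_cat /= => /and3P[_ _ /andP[_ /andP[/andP[/andP[jl _] _] _]]].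
by rewrite /leq_ord_rel leqNgt lj in jl.
Qed.

Lemma normal_or_rule w : (exists2 e, normal_exps D e & w = nlet e) \/
  (exists x1 L R s x2, rule L R s /\ w = x1 ++ L ++ x2).
Proof.
case: (boolP (sorted (@leq_ord_rel n) w)) => [sw|/unsorted_split]; last first.
  move=> [x1 [j [l [x2 [-> lj]]]]]; right.
  by exists x1, [:: j; l], (l :: vw l j), (t l j), x2; split=> //; constructor.
have wE := nlet_count sw; set e := finfun _ in wE.
have [/forallP he|] := boolP [forall l, e l < q l]; first by left; exists e.
rewrite negb_forall => /existsP[l]; rewrite -leqNgt => ql; right.
have [x1 [x2 eE]] := nlet_infix e l.
exists x1, (nseq (q l) l), (vw l l), (t l l), (nseq (e l - q l) l ++ x2).
by split; [constructor | rewrite {1}wE eE [nseq _ _ ++ _ ++ _]catA -nseqD subnKC].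
Qed.

Lemma red_normal e w' m : normal_exps D e -> red (nlet e) w' m ->
  w' = nlet e /\ m = 0%R.
Proof.
move=> he r; case: {-1}_ _ _ / r (erefl (nlet e)) => // x1 L R s x2 w {}m r _.
by move=> eE; case: (rule_normal he eE r).
Qed.

(** The successor keeps the bound positive even if all right-hand sides are empty, as [phi_leq]
    requires. *)
Definition vbound : nat := (\max_(jk : 'I_n * 'I_n) size (vw jk.1 jk.2)).+1.

Definition weight (x : nat) (w : seq 'I_n) : nat :=
  foldl (fun x (l : 'I_n) => phi vbound (n - l) x) x w.

Lemma weight_cat x w w' : weight x (w ++ w') = weight (weight x w) w'.
Proof. exact: foldl_cat. Qed.

Lemma weight_mono w x y : x < y -> weight x w < weight y w.
Proof. by elim: w x y => //= l w IHw x y lt_xy; apply/IHw/phi_mono. Qed.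

Lemma weight_infl w x : x <= weight x w.
Proof. by elim: w x => //= l w IHw x; apply: leq_trans (IHw _); apply/ltnW/phi_gt. Qed.

Lemma weight_iter w d x : size w <= vbound -> (forall l : 'I_n, l \in w -> n - l <= d) ->
  weight x w <= iter vbound (phi vbound d) x.
Proof.
move=> sw hw; apply: leq_trans (_ : iter (size w) (phi vbound d) x <= _); last first.
  exact: (iter_leq (phi_gt _ _)).
elim/last_ind: w {sw} hw => //= w l IHw hw.
rewrite -cats1 weight_cat /= cats1 size_rcons iterS.
apply: leq_trans (phi_leq _ _ (hw l _)) _ => //; first by rewrite mem_rcons mem_head.
apply/phi_mono_le/IHw => k kw; apply: hw; by rewrite mem_rcons inE kw orbT.
Qed.

Lemma weight_rhs (j k : 'I_n) x : j <= k ->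
  weight x (vw j k) <= iter vbound (phi vbound (n - j).-1) x.
Proof.
move=> jk; apply: weight_iter => [|l /(vw_gt jk) jl].
  by apply: leqW; apply: (leq_bigmax (j, k)).
by have := ltn_ord l; lia.
Qed.

(** In a power rule a single letter of the left-hand side already outweighs the right-hand side. In
    a conjugation rule [l] occurs on both sides, but on the left it is applied to the larger
    argument [phi vbound (n - j) x], so that [phiS_lt] applies. *)
Lemma weight_rule L R s x : rule L R s -> weight x R < weight x L.
Proof.
have nE (j : 'I_n) : n - j = (n - j).-1.+1 by have := ltn_ord j; lia.
case=> [l|l j lj].
  apply: leq_ltn_trans (weight_rhs x (leqnn l)) _.
  apply: leq_trans (phiS_iter _ _ _) _; rewrite -nE -(prednK (q_gt0 l)) /=.
  exact: weight_infl.
apply: leq_ltn_trans (weight_rhs _ (ltnW lj)) _ => /=.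
by have := phiS_lt vbound (n - l).-1 (phi_gt vbound (n - j) x); rewrite -nE.
Qed.

Lemma weight_step x1 L R s x2 : rule L R s ->
  weight 0 (x1 ++ R ++ x2) < weight 0 (x1 ++ L ++ x2).
Proof. by move=> r; rewrite !weight_cat; apply/weight_mono/(weight_rule _ r). Qed.

(** Only the tail is recorded: under consistency the normal word is fixed by the value of [w] in
    [K]. *)
Definition nfv w m := exists2 e, normal_exps D e & red w (nlet e) m.

Lemma nfv_ex w : exists m, nfv w m.
Proof.
have [N] := ubnP (weight 0 w); elim: N w => // N IHN w wN.
have [[e he ->]|[x1 [L [R [s [x2 [r wE]]]]]]] := normal_or_rule w.
  by exists 0%R, e => //; apply: Red0.
have [|m [e he rw]] := IHN (x1 ++ R ++ x2).
  by have := weight_step x1 x2 r; rewrite -wE; lia.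
by exists (act s (ev x2) + m)%R, e => //; rewrite wE; apply: RedS rw.
Qed.

Lemma nfv_inv w m : nfv w m ->
  (exists2 e, normal_exps D e & w = nlet e /\ m = 0%R) \/
  exists x1 L R s x2 m', [/\ rule L R s, w = x1 ++ L ++ x2,
    nfv (x1 ++ R ++ x2) m' & m = (act s (ev x2) + m')%R].
Proof.
move=> [e he]; move eE: (nlet e) => z r.
case: {w z m} r eE => [w wE|x1 L R s x2 w m r rw wE]; first by left; exists e.
by right; exists x1, L, R, s, x2, m; split=> //; exists e; rewrite ?wE.
Qed.

Lemma red_nfv w w' m m' : red w w' m -> nfv w' m' -> nfv w (m + m')%R.
Proof. by move=> r [e he r']; exists e => //; apply: red_trans r'. Qed.

(** Joinability of a critical pair: one rule has been applied on either side, with right-hand sides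
    [R], [R'] and tails [s], [s']. The common word [V] need not be normal. *)
Definition joins x1 R s x2 x1' R' s' x2' := exists V m m',
  [/\ red (x1 ++ R ++ x2) V m, red (x1' ++ R' ++ x2') V m' &
      (act s (ev x2) + m = act s' (ev x2') + m')%R].

Hypothesis test_conj : forall i j k : 'I_n, i < j -> j < k ->
  joins [::] (j :: vw j k) (t j k) [:: i] [:: k] (i :: vw i j) (t i j) [::].
Hypothesis test_powl : forall j k : 'I_n, j < k ->
  joins [::] (vw k k) (t k k) [:: j]
        (nseq (q k).-1 k) (j :: vw j k) (t j k) [::].
Hypothesis test_powr : forall i j : 'I_n, i < j ->
  joins [::] (i :: vw i j) (t i j) (nseq (q i).-1 i)
        [:: j] (vw i i) (t i i) [::].
Hypothesis test_pow : forall i : 'I_n,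
  joins [::] (vw i i) (t i i) [:: i] [:: i] (vw i i) (t i i) [::].

(** * Local confluence, given uniqueness of tails for words of smaller weight *)

Section Peak.

Variable N : nat.
Hypothesis IHN : forall w, weight 0 w < N ->
  forall m m', nfv w m -> nfv w m' -> m = m'.

Definition peak x1 R s x2 x1' R' s' x2' := forall m m',
  nfv (x1 ++ R ++ x2) m -> nfv (x1' ++ R' ++ x2') m' ->
  (act s (ev x2) + m = act s' (ev x2') + m')%R.

(** Both one-step reducts weigh less than [N], so their tails may be computed along the way through
    [V]. *)
Lemma peak_joins z1 z2 x1 L R s x2 x1' L' R' s' x2' :
  rule L R s -> rule L' R' s' ->
  weight 0 (z1 ++ x1 ++ L ++ x2 ++ z2) <= N ->
  z1 ++ x1' ++ L' ++ x2' ++ z2 = z1 ++ x1 ++ L ++ x2 ++ z2 ->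
  joins x1 R s x2 x1' R' s' x2' ->
  peak (z1 ++ x1) R s (x2 ++ z2) (z1 ++ x1') R' s' (x2' ++ z2).
Proof.
move=> r r' wN eqW [V [m [m' [rV rV' eqm]]]] l l' nl nl'.
have {rV}rV := red_ctx z1 z2 rV; have {rV'}rV' := red_ctx z1 z2 rV'.
rewrite -!catA in rV rV' nl nl' *.
have [k nk] := nfv_ex (z1 ++ V ++ z2).
have -> := IHN _ nl (red_nfv rV nk); last first.
  by apply: leq_trans wN; have := weight_step (z1 ++ x1) (x2 ++ z2) r; rewrite -!catA.
have -> := IHN _ nl' (red_nfv rV' nk); last first.
  rewrite -eqW in wN.
  by apply: leq_trans wN; have := weight_step (z1 ++ x1') (x2' ++ z2) r'; rewrite -!catA.
by rewrite !addrA !wordev_cat !(ractM hact) -!(ractD hact) eqm.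
Qed.

(** The two rules commute: the tail [s] is moved past [L'] or [R'], which have the same value in [K]
    and so act alike. *)
Lemma peak_disjoint x1 L R s u L' R' s' x2' :
  rule L R s -> rule L' R' s' ->
  weight 0 (x1 ++ L ++ u ++ L' ++ x2') <= N ->
  peak x1 R s (u ++ L' ++ x2') (x1 ++ L ++ u) R' s' x2'.
Proof.
move=> r r' wN l l' nl nl'.
have [k nk] := nfv_ex (x1 ++ R ++ u ++ R' ++ x2').
have rV : red (x1 ++ R ++ u ++ L' ++ x2') (x1 ++ R ++ u ++ R' ++ x2') (act s' (ev x2')).
  by have := RedS r' (Red0 ((x1 ++ R ++ u) ++ R' ++ x2')); rewrite addr0 -!catA.
have rV' : red (x1 ++ L ++ u ++ R' ++ x2') (x1 ++ R ++ u ++ R' ++ x2')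
    (act s (ev (u ++ R' ++ x2'))).
  by have := RedS r (Red0 (x1 ++ R ++ u ++ R' ++ x2')); rewrite addr0.
rewrite -!catA in nl'.
have -> := IHN _ nl (red_nfv rV nk); last first.
  by apply: leq_trans wN; apply: weight_step r.
have -> := IHN _ nl' (red_nfv rV' nk); last first.
  by apply: leq_trans wN; have := weight_step (x1 ++ L ++ u) x2' r'; rewrite -!catA.
by rewrite !addrA !wordev_cat (rule_ev r') [X in (X + k = _)%R]addrC.
Qed.

(** The rule can be applied at each of the positions between the two given ones. Neighbouring
    positions form the overlap of [test_pow], and the tails are equated along this chain. *)
Lemma peak_pow x1 l d x2 : weight 0 (x1 ++ nseq (q l) l ++ nseq d l ++ x2) <= N ->
  peak x1 (vw l l) (t l l) (nseq d l ++ x2) (x1 ++ nseq d l) (vw l l) (t l l) x2.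
Proof.
elim: d x1 => [|d IHd] x1 wN m m' /=.
  rewrite cats0 => nm nm'; congr (_ + _)%R; apply: IHN nm nm'.
  by apply: leq_trans wN; apply/weight_step/Rpow.
have eqW z : x1 ++ nseq (q l) l ++ l :: z = (x1 ++ [:: l]) ++ nseq (q l) l ++ z.
  by rewrite -catA /= nseq_cat_cons.
move=> nm nm'; have [k nk] := nfv_ex ((x1 ++ [:: l]) ++ vw l l ++ nseq d l ++ x2).
have := @peak_joins x1 (nseq d l ++ x2) _ _ _ _ _ _ _ _ _ _ (Rpow l) (Rpow l) _ _ (test_pow l).
rewrite cats0 => /(_ wN) pk; rewrite (pk _ m k) //; last first.
  by rewrite /= eqW -catA.
apply: (IHd (x1 ++ [:: l])) => //; last by rewrite -!catA in nm' *.
by rewrite -eqW.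
Qed.

(* Two rules overlap as in a consistency test, except that two power rules may
   overlap in fewer letters; [peak_pow] reduces this case to the test. *)
Lemma peak_overlap x1 L R s x2 u L' R' s' x2' :
  rule L R s -> rule L' R' s' ->
  L ++ x2 = u ++ L' ++ x2' -> weight 0 (x1 ++ L ++ x2) <= N ->
  peak x1 R s x2 (x1 ++ u) R' s' x2'.
Proof.
move=> r r' eqW wN.
have same : u = [::] -> L = L' -> R = R' -> s = s' -> x2 = x2' -> peak x1 R s x2 (x1 ++ u) R' s' x2'.
  move=> -> eL eR es ex m m'; subst; rewrite cats0 => nm nm'; congr (_ + _)%R.
  by apply: IHN nm nm'; apply: leq_trans wN; apply: weight_step r.
have q2 l : nseq (q l) l = [:: l, l & nseq (q l).-2 l] by have := q_gt1 l; case: (q l) => [|[]].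
have q1 l : nseq (q l) l = l :: nseq (q l).-1 l by have := q_gt1 l; case: (q l).
(* If [u] covers [L], the rules act on disjoint factors; otherwise [L'] begins inside [L]. *)
case: (leqP (size L) (size u)) => [Lu|uL].
  have uE : u = L ++ drop (size L) u.
    rewrite -{1}(cat_take_drop (size L) u); congr (_ ++ _).
    by move/(congr1 (take (size L))): eqW; rewrite take_size_cat // takel_cat.
  move: (drop _ _) uE => z uE; rewrite uE -catA in eqW *.
  by move/eqP: eqW; rewrite eqseq_cat // eqxx /= => /eqP x2E; subst; apply: peak_disjoint.
case: r uL eqW wN same => [l|l j lj] uL eqW wN same; last first.
  case: u uL eqW same => [|c [|//]] _ /=.
    case: r' => [l'|l' j' lj']; last first.
      by move=> [-> -> ->]; apply.
    rewrite q2 => -[jl' ll' _]; by rewrite jl' ll' ltnn in lj.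
  case: r' => [l'|l' j' lj'] /= [<-{c}].
    rewrite {1}q1 => -[ll' x2E] _; subst l' x2.
    have := @peak_joins x1 x2' [::] [:: j; l] _ _ _ _ _ _ _ _ (Rconj lj) (Rpow l) _ _ (test_powr lj).
    by rewrite cats0; apply; rewrite ?wN //= q1.
  move=> [ll' x2E] _; subst j' x2.
  have := @peak_joins x1 x2' [::] [:: j; l] _ _ _ _ _ _ _ _ (Rconj lj) (Rconj lj') _ _ (test_conj lj' lj).
  by rewrite cats0; apply.
rewrite size_nseq in uL.
have uE : u = nseq (size u) l.
  have uq := ltnW uL; have := congr1 (take (size u)) eqW.
  rewrite (take_size_cat (L' ++ x2') (erefl (size u))) takel_cat ?size_nseq // => uE.
  by rewrite -{1}uE take_nseq.
move: (size u) uL uE => d dq uE; subst u.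
have {eqW}: nseq (q l - d) l ++ x2 = L' ++ x2'.
  move/eqP: eqW; rewrite -{1}(subnKC (ltnW dq)) nseqD -catA eqseq_cat // eqxx /=.
  by move/eqP.
(* After [u] there remain [d'.+1] letters [l] of the left-hand side. A conjugation rule begins with
   two different letters, so it can only start at the last of them. *)
have [d' dE] : exists d', q l - d = d'.+1 by exists (q l - d).-1; lia.
rewrite dE; case: r' same => [l'|l' j' lj'] /= same; last first.
  move=> [lj'E x2E]; subst j'; case: d' dE x2E => [|d'] dE /= x2E; last first.
    by case: x2E => ll'; rewrite ll' ltnn in lj'.
  subst x2; have -> : d = (q l).-1 by lia.
  have := @peak_joins x1 x2' [::] (nseq (q l) l) _ _ _ _ _ _ _ _ (Rpow l) (Rconj lj') _ _ (test_powl lj').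
  rewrite cats0; apply=> //=; congr (_ ++ _).
  by rewrite nseq_cat_cons [in RHS]q1.
rewrite {1}q1 => -[ll' x2E]; subst l'.
have x2E' : x2 = nseq d l ++ x2'.
  have qE : (q l).-1 = d' + d by lia.
  by move/eqP: x2E; rewrite qE nseqD -catA eqseq_cat // eqxx => /eqP.
by subst x2; apply: peak_pow.
Qed.

End Peak.

(** Newman's argument by induction on the weight: the first steps of two collections of [w] form a
    peak. *)
Theorem red_confluent w m m' : nfv w m -> nfv w m' -> m = m'.
Proof.
have [N] := ubnP (weight 0 w); elim: N w m m' => // N IHN w m m' wN nm nm'.
have IH w' : weight 0 w' < N -> forall m m', nfv w' m -> nfv w' m' -> m = m'.
  by move=> w'N k k'; apply: IHN.
have [[e he [wE m0]]|[x1 [L [R [s [x2 [k [r wE nk mE]]]]]]]] := nfv_inv nm.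
  by case: nm' => e' he'; rewrite wE => /(red_normal he)[_ ->].
have [[e he [wE' _]]|[x1' [L' [R' [s' [x2' [k' [r' wE' nk' mE']]]]]]]] := nfv_inv nm'.
  by rewrite wE' in wE; case: (rule_normal he wE r).
have eqW : x1 ++ L ++ x2 = x1' ++ L' ++ x2' by rewrite -wE.
rewrite mE mE'; wlog le_x : x1 L R s x2 k r wE nk {mE} x1' L' R' s' x2' k' r' wE' nk' {mE'}
    eqW / size x1 <= size x1' => [WL|].
  case: (leqP (size x1) (size x1')) => [|/ltnW] le_x.
    exact: (WL _ _ _ _ _ _ r wE nk _ _ _ _ _ _ r' wE' nk' eqW le_x).
  exact/esym/(WL _ _ _ _ _ _ r' wE' nk' _ _ _ _ _ _ r wE nk (esym eqW) le_x).
have x1E : x1' = x1 ++ drop (size x1) x1'.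
  rewrite -{1}(cat_take_drop (size x1) x1'); congr (_ ++ _).
  by move/(congr1 (take (size x1))): eqW; rewrite take_size_cat // takel_cat.
move: (drop _ _) x1E => u x1E; subst x1'.
apply: (peak_overlap IH r r') nk nk'; last by rewrite -wE -ltnS.
by move/eqP: eqW; rewrite -catA eqseq_cat // eqxx => /eqP.
Qed.

End Reduction.

(** * The extension defined by consistent tails *)

Record is_cocycle (K : groupType) (M : zmodType) (act : M -> K -> M)
    (c : K -> K -> M) : Prop := IsCocycle {
  coc_act : is_act act;
  cocA : forall x y z, (act (c x y) z + c (x * y)%g z = c y z + c x (y * z)%g)%R;
  coc1l : forall x, c 1%g x = 0%R;
  coc1r : forall x, c x 1%g = 0%R
}.

Section CocycleGroup.

Variables (K : groupType) (M : zmodType) (act : M -> K -> M) (c : K -> K -> M).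

(** The pair [(x, m)] stands for a representative of [x] followed by [m]. The cocycle proof is a
    parameter so that the type can carry the group structure. *)
Definition cext (hc : is_cocycle act c) : Type := (K * M)%type.

Variable hc : is_cocycle act c.
Let hact := coc_act hc.

HB.instance Definition _ := Choice.copy (cext hc) (K * M)%type.

Definition cext_mul (u v : cext hc) : cext hc :=
  ((u.1 * v.1)%g, (act u.2 v.1 + v.2 + c u.1 v.1)%R).
Definition cext_one : cext hc := (1%g, 0%R).
Definition cext_inv (u : cext hc) : cext hc :=
  ((u.1^-1)%g, (- (act u.2 (u.1^-1)%g + c u.1 (u.1^-1)%g))%R).

Fact cext_mulA : associative cext_mul.
Proof.
move=> [x m] [y m'] [z m'']; congr (_, _) => /=; first by rewrite mulgA.
rewrite !(ractD hact) (ractM hact) -!addrA; congr (_ + (_ + _))%R.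
by rewrite -(cocA hc) addrCA.
Qed.

Fact cext_mul1 : left_id cext_one cext_mul.
Proof.
move=> [x m]; rewrite /cext_mul /= mul1g (ract0 hact) (coc1l hc).
by rewrite addr0 add0r.
Qed.

Fact cext_1mul : right_id cext_one cext_mul.
Proof.
by move=> [x m]; rewrite /cext_mul /= mulg1 (ract1 hact) (coc1r hc) !addr0.
Qed.

Fact cext_mulV : right_inverse cext_one cext_inv cext_mul.
Proof.
move=> [x m]; rewrite /cext_mul /= mulgV; congr (_, _).
by rewrite addrAC subrr.
Qed.

Fact cext_Vmul : left_inverse cext_one cext_inv cext_mul.
Proof.
move=> u; rewrite -[LHS]cext_1mul -(cext_mulV (cext_inv u)) cext_mulA.
by rewrite -(cext_mulA _ u) cext_mulV cext_1mul cext_mulV.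
Qed.

HB.instance Definition _ :=
  isGroup.Build (cext hc) cext_mulA cext_mul1 cext_1mul cext_Vmul cext_mulV.

Definition cext_pr (u : cext hc) : K := u.1.

Fact cext_pr_mul : {morph cext_pr : u v / (u * v)%g}. Proof. by []. Qed.

HB.instance Definition _ := isMultiplicative.Build (cext hc) K cext_pr cext_pr_mul.

Definition cext_io (m : M) : cext hc := (1%g, m).

Lemma cext_ioD m m' : cext_io (m + m')%R = (cext_io m * cext_io m')%g.
Proof.
by congr (_, _) => /=; rewrite ?mul1g // (ract1 hact) (coc1l hc) addr0.
Qed.

Lemma cext_ioJ m u : (cext_io m ^ u)%g = cext_io (act m (cext_pr u)).
Proof.
apply: (mulgI u); rewrite conjgE mulVKg; case: u => x k; congr (_, _) => /=.
  by rewrite mul1g mulg1.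
by rewrite (ract1 hact) (coc1l hc) (coc1r hc) !addr0 addrC.
Qed.

End CocycleGroup.

Section TailExtension.

Variables (n : nat) (D : pcpres n) (K : groupType) (a : 'I_n -> K).
Hypotheses (hD : pc_wf D) (ha : pc_rels D a) (hcons : consistent D a).
Variables (M : zmodType) (act : M -> K -> M) (hact : is_act act).
Variable t : 'I_n -> 'I_n -> M.

Local Notation ev := (wordev a).
Local Notation q := (pcq D).
Local Notation red := (red D a act t).
Local Notation nfv := (nfv D a act t).
Local Notation vw j k := (nlet (pcv D j k)).

Hypothesis confluent : forall w m m', nfv w m -> nfv w m' -> m = m'.

Let nf_ex x : exists e, normal_exps D e /\ x = nword a e.
Proof. by have [e [? _]] := hcons x; exists e. Qed.

Let nf x : exps n := projT1 (cid (nf_ex x)).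

Let nf_normal x : normal_exps D (nf x).
Proof. by case: (projT2 (cid (nf_ex x))). Qed.

Let nf_ev x : nword a (nf x) = x.
Proof. by case: (projT2 (cid (nf_ex x))) => _ <-. Qed.

Let nf_uniq e : normal_exps D e -> nf (nword a e) = e.
Proof.
move=> he; have [e' [_ ue]] := hcons (nword a e).
rewrite -[RHS](ue e (conj he erefl)); apply/esym/ue.
by split; rewrite ?nf_ev //; apply: nf_normal.
Qed.

(** By [confluent] the chosen tail is the one that every collection of [w] leaves. *)
Let rho w : M := projT1 (cid (nfv_ex a hD act t w)).

Let rhoP w : nfv w (rho w).
Proof. exact: projT2 (cid (nfv_ex a hD act t w)). Qed.

Let nw x := nlet (nf x).

Let nw_ev x : ev (nw x) = x.
Proof. by rewrite wordev_nlet nf_ev. Qed.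

Let rho_red w : red w (nw (ev w)) (rho w).
Proof.
have [e he r] := rhoP w; suff -> : nw (ev w) = nlet e by [].
by rewrite (red_ev ha r) wordev_nlet /nw nf_uniq.
Qed.

Let red_rho w w' m : red w w' m -> rho w = (m + rho w')%R.
Proof. by move=> r; apply: (confluent (rhoP w)); apply: red_nfv r (rhoP w'). Qed.

Let rho_catl w w' : rho (w ++ w') = (act (rho w) (ev w') + rho (nw (ev w) ++ w'))%R.
Proof. by apply: red_rho; apply: red_catr => //; apply: rho_red. Qed.

Let rho_catr w w' : rho (w ++ w') = (rho w' + rho (w ++ nw (ev w')))%R.
Proof. by apply: red_rho; apply: red_catl => //; apply: rho_red. Qed.

Let rho_normal e : normal_exps D e -> rho (nlet e) = 0%R.
Proof. by move=> he; apply: confluent (rhoP _) _; exists e => //; apply: Red0. Qed.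

(** The factor set for the transversal of normal words with zero tail. *)
Let coc x y := rho (nw x ++ nw y).

Let nw1 : nw 1%g = [::].
Proof.
have e0 : normal_exps D (exps0 n) by move=> l; rewrite ffunE; apply: q_gt0.
by have := nf_uniq e0; rewrite /nw -wordev_nlet nlet0 wordev_nil => ->; rewrite nlet0.
Qed.

Let coc_cocycle : is_cocycle act coc.
Proof.
split=> // [x y z|x|x]; last 2 first.
- by rewrite /coc nw1 rho_normal.
- by rewrite /coc nw1 cats0 rho_normal.
(* The tail of a product of three normal words is computed twice, collecting the left or the right
   pair first. *)
have := rho_catl (nw x ++ nw y) (nw z); rewrite -catA rho_catr.
by rewrite !wordev_cat !nw_ev => <-.
Qed.

Let E : groupType := cext coc_cocycle.
Let al (l : 'I_n) : E := (a l, 0%R).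

(** This ties the group law to collection, so that a relation between the [al l] can be read off
    from a single collection step. *)
Let al_ev w : wordev al w = (ev w, rho w).
Proof.
elim/last_ind: w => [|w l IHw].
  by rewrite !wordev_nil -nlet0 rho_normal // => l; rewrite ffunE; apply: q_gt0.
rewrite -cats1 !wordev_cat !wordev1 IHw rho_catl wordev1; congr (_, _).
rewrite /= addr0; congr (_ + rho (_ ++ _))%R.
have e1 : normal_exps D (exps1 l).
  by move=> k; rewrite ffunE; case: eqP => _; [apply: q_gt1 | apply: q_gt0].
by have := nf_uniq e1; rewrite /nw -wordev_nlet nlet1 wordev1 => ->; rewrite nlet1.
Qed.

Let al_rule L R s : rule D t L R s ->
  wordev al L = (wordev al R * cext_io coc_cocycle s)%g.
Proof.
move=> r; rewrite !al_ev; congr (_, _) => /=; first by rewrite mulg1 (rule_ev ha r).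
rewrite (ract1 hact) (coc1r coc_cocycle) addr0 addrC.
apply: red_rho; have r0 := Red0 D a act t ([::] ++ R ++ [::]); have := RedS r r0.
by rewrite wordev_nil (ract1 hact) addr0 /= !cats0.
Qed.

Theorem tail_extension : exists (E : groupType) (io : M -> E)
    (pr : {multiplicative E -> K}) (al : 'I_n -> E),
  [/\ injective io,
      forall m m', io (m + m')%R = (io m * io m')%g,
      forall m x, (io m ^ x)%g = io (act m (pr x)),
      forall x, pr x = 1%g <-> exists m, x = io m &
      forall l, pr (al l) = a l] /\
  (forall l, (al l ^+ q l = nword al (pcv D l l) * io (t l l))%g) /\
  (forall j k : 'I_n, j < k -> (al k ^ al j = nword al (pcv D j k) * io (t j k))%g).
Proof.
exists E, (cext_io coc_cocycle), (cext_pr (hc := coc_cocycle)), al.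
split; first split=> //.
- by move=> m m' [].
- exact: cext_ioD.
- exact: cext_ioJ.
- by move=> [x m]; split=> [/= x1|[m' ->]] //; exists m; congr (_, _).
split=> [l|j k jk].
  by have := al_rule (Rpow D t l); rewrite wordev_nseq wordev_nlet.
have := al_rule (Rconj D t jk); rewrite !wordev_cons wordev_nil mulg1 wordev_nlet.
by rewrite -mulgA conjgE => ->; rewrite mulKg.
Qed.

End TailExtension.

(** * The free module *)

Section FreeModule.

Variables (p : nat) (Q : finGroupType) (X : finType).
Local Notation A := (groupring 'F_p Q).
Local Notation Z := (freemod A X).
Local Open Scope ring_scope.

Definition zsingle (x : X) (f : A) : Z := [ffun x' => if x' == x then f else 0].

Lemma zsingleD x f f' : zsingle x (f + f') = zsingle x f + zsingle x f'.
Proof. by apply/ffunP=> y; rewrite !ffunE; case: eqP; rewrite ?addr0. Qed.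

Lemma zsingle_scale x f c : rscale (zsingle x f) c = zsingle x (f * c).
Proof. by apply/ffunP=> y; rewrite !ffunE; case: eqP; rewrite ?mul0r. Qed.

Lemma rscaleD (z z' : Z) c : rscale (z + z') c = rscale z c + rscale z' c.
Proof. by apply/ffunP=> y; rewrite !ffunE mulrDl. Qed.

Lemma rscaleDr (z : Z) c d : rscale z (c + d) = rscale z c + rscale z d.
Proof. by apply/ffunP=> y; rewrite !ffunE mulrDr. Qed.

Lemma rscaleM (z : Z) c d : rscale (rscale z c) d = rscale z (c * d).
Proof. by apply/ffunP=> y; rewrite !ffunE mulrA. Qed.

Lemma rscale1 (z : Z) : rscale z 1 = z.
Proof. by apply/ffunP=> y; rewrite !ffunE mulr1. Qed.

Lemma rscale0r (z : Z) : rscale z 0 = 0.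
Proof. by apply/ffunP=> y; rewrite !ffunE mulr0. Qed.

Lemma gr_eltM (c d : Q) : gr_elt 'F_p c * gr_elt 'F_p d = gr_elt 'F_p (c * d)%g.
Proof.
apply/ffunP=> x; rewrite !ffunE (bigD1 c) //= big1 => [|y yc].
  by rewrite !ffunE eqxx mul1r addr0 -(inj_eq (mulgI c)) mulKVg.
by rewrite ffunE (negPf yc) mul0r.
Qed.

Lemma gr_decomp (f : A) : f = \sum_(c : Q) gr_elt 'F_p c *+ (f c : nat).
Proof.
apply/ffunP=> x; rewrite sum_ffunE (bigD1 x) //= big1 => [|c cx].
  by rewrite ffunMnE ffunE eqxx addr0 natr_Zp.
by rewrite ffunMnE ffunE eq_sym (negPf cx) mul0rn.
Qed.

Lemma rscale_decomp (z : Z) (f : A) :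
  rscale z f = \sum_(c : Q) rscale z (gr_elt 'F_p c) *+ (f c : nat).
Proof.
rewrite {1}[f]gr_decomp (big_morph _ (rscaleDr z) (rscale0r z)).
apply: eq_bigr => c _; elim: (f c : nat) => [|k IHk].
  by rewrite !mulr0n rscale0r.
by rewrite !mulrS rscaleDr IHk.
Qed.

Lemma freemod_decomp (z : Z) :
  z = \sum_(x : X) \sum_(c : Q) rscale (zsingle x 1) (gr_elt 'F_p c) *+ (z x c : nat).
Proof.
apply/ffunP=> x; rewrite sum_ffunE (bigD1 x) //= [X in _ + X]big1 => [|y yx].
  rewrite addr0 sum_ffunE [LHS]gr_decomp; apply: eq_bigr => c _.
  by rewrite ffunMnE !ffunE eqxx mul1r.
rewrite sum_ffunE big1 // => c _.
by rewrite ffunMnE !ffunE eq_sym (negPf yx) mul0r mul0rn.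
Qed.

Section Linear.

Variables (M : zmodType) (act : M -> Q -> M) (hact : is_act act).

Record is_rlinear (F : Z -> M) : Prop := IsRLinear {
  rlinD : forall z z', F (z + z') = F z + F z';
  rlinJ : forall z c, F (rscale z (gr_elt 'F_p c)) = act (F z) c
}.

Section Theory.

Variables (F : Z -> M) (hF : is_rlinear F).

Lemma rlin0 : F 0 = 0.
Proof. by apply: (addrI (F 0)); rewrite -(rlinD hF) !addr0. Qed.

Lemma rlinMn z k : F (z *+ k) = F z *+ k.
Proof. by elim: k => [|k IHk]; rewrite ?mulr0n ?rlin0 // !mulrS (rlinD hF) IHk. Qed.

Lemma rlinN z : F (- z) = - F z.
Proof. by apply: (addrI (F z)); rewrite -(rlinD hF) !subrr rlin0. Qed.

Lemma rlin_sum (I : Type) (r : seq I) (P : pred I) G :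
  F (\sum_(i <- r | P i) G i) = \sum_(i <- r | P i) F (G i).
Proof. exact: (big_morph _ (rlinD hF) rlin0). Qed.

Lemma rlin_scale z f : F (rscale z f) = \sum_(c : Q) act (F z) c *+ (f c : nat).
Proof.
rewrite rscale_decomp rlin_sum; apply: eq_bigr => c _.
by rewrite rlinMn (rlinJ hF).
Qed.

Lemma rlin_decomp z :
  F z = \sum_(x : X) \sum_(c : Q) act (F (zsingle x 1)) c *+ (z x c : nat).
Proof.
rewrite {1}[z]freemod_decomp rlin_sum; apply: eq_bigr => x _.
rewrite rlin_sum; apply: eq_bigr => c _.
by rewrite rlinMn (rlinJ hF).
Qed.

Lemma rlin_span (S : Z -> Prop) : (forall z, S z -> F z = 0) ->
  forall z, z \in rspan S -> F z = 0.
Proof.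
move=> SF z /asboolP[k [s [c [Ss ->]]]]; rewrite rlin_sum big1 // => l _.
rewrite rlin_scale big1 // => d _; by rewrite SF // (ract0 hact) mul0rn.
Qed.

End Theory.

Hypotheses (hp : prime p) (tors : forall m : M, m *+ p = 0).
Variable y : X -> M.

Lemma tors_mod (m : M) k : m *+ (k %% p) = m *+ k.
Proof. by rewrite [in RHS](divn_eq k p) mulrnDr mulnC mulrnA tors mul0rn add0r. Qed.

(** The natural numbers representing [u + v] and the sum of the representatives differ by a multiple
    of [p], which kills [M]. *)
Lemma mulrn_FpD (m : M) (u v : 'F_p) : m *+ (u + v)%R = m *+ u + m *+ v.
Proof.
have -> : u + v = (u + v)%N%:R :> 'F_p by rewrite natrD !natr_Zp.
by rewrite (val_Fp_nat hp) tors_mod mulrnDr.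
Qed.

(** The linear map given by the universal property of the free module, with prescribed values [y] on
    the basis. *)
Definition free_ext (z : Z) : M :=
  \sum_(x : X) \sum_(c : Q) act (y x) c *+ (z x c : nat).

Lemma free_ext_linear : is_rlinear free_ext.
Proof.
split=> [z z'|z d].
  rewrite /free_ext -big_split; apply: eq_bigr => x _ /=.
  by rewrite -big_split; apply: eq_bigr => c _; rewrite !ffunE mulrn_FpD.
have actS (I : Type) (r : seq I) G :
    act (\sum_(i <- r) G i) d = \sum_(i <- r) act (G i) d.
  by apply: (big_morph (act^~ d)) => [m m'|]; rewrite ?(ractD hact) ?(ract0 hact).
rewrite /free_ext actS; apply: eq_bigr => x _; rewrite actS.
rewrite (reindex_inj (mulIg d)); apply: eq_bigr => c _.
have actMn m k : act (m *+ k) d = act m d *+ k.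
  by elim: k => [|k IHk]; rewrite ?mulr0n ?(ract0 hact) // !mulrS (ractD hact) IHk.
rewrite actMn -(ractM hact); congr (_ *+ _); congr (nat_of_ord _).
rewrite !ffunE (bigD1 c) //= big1 => [|c' c'c].
  by rewrite ffunE mulKg eqxx mulr1 addr0.
rewrite ffunE -(inj_eq (mulgI c')) mulKVg (inj_eq (mulIg d)) eq_sym (negPf c'c).
by rewrite mulr0.
Qed.

Lemma free_ext_single x : free_ext (zsingle x 1) = y x.
Proof.
rewrite /free_ext (bigD1 x) //= [X in _ + X]big1 => [|x' x'x].
  rewrite addr0 (bigD1 1%g) //= big1 => [|c c1].
    by rewrite !ffunE eqxx ffunE eqxx (ract1 hact) addr0.
  by rewrite !ffunE eqxx ffunE (negPf c1).
by rewrite big1 // => c _; rewrite !ffunE (negPf x'x) ffunE.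
Qed.

End Linear.

End FreeModule.

(** * The first step in collecting the left-hand side of a rule is forced *)

Section FirstStep.

Variables (n : nat) (D : pcpres n) (K : groupType) (a : 'I_n -> K).
Hypothesis hD : pc_wf D.
Variables (M : zmodType) (act : M -> K -> M) (t : 'I_n -> 'I_n -> M).
Local Notation rule := (rule D t).

(** A power has equal letters and a conjugation rule two different ones, so neither kind of
    left-hand side contains the other; those of the same kind have equal length. *)
Lemma rule_minimal x1 L R s x2 L' R' s' :
  rule L R s -> rule L' R' s' -> L = x1 ++ L' ++ x2 ->
  [/\ x1 = [::], x2 = [::], R' = R & s' = s].
Proof.
have q2 l : nseq (pcq D l) l = [:: l, l & nseq (pcq D l).-2 l].
  by have := q_gt1 hD l; case: (pcq D l) => [|[]].
case=> [l|l j lj]; case=> [l'|l' j' lj'] eL.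
- have l'l : l' = l.
    have: l' \in nseq (pcq D l) l by rewrite eL q2 !mem_cat !inE eqxx orbT.
    by rewrite mem_nseq => /andP[_ /eqP].
  subst l'; move/(congr1 size): eL; rewrite !size_cat size_nseq => sE.
  have /size0nil -> : size x1 = 0 by lia.
  by have /size0nil -> : size x2 = 0 by lia.
- have inl k : k \in [:: j'; l'] -> k = l.
    move=> kin; have: k \in nseq (pcq D l) l by rewrite eL !mem_cat kin orbT.
    by rewrite mem_nseq => /andP[_ /eqP].
  have ll : l' = l by apply: inl; rewrite !inE eqxx orbT.
  have jl : j' = l by apply: inl; rewrite inE eqxx.
  by rewrite ll jl ltnn in lj'.
- rewrite q2 in eL; have /size0nil x10 : size x1 = 0.
    by move/(congr1 size): eL; rewrite !size_cat /=; lia.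
  by move: eL; rewrite x10 /= => -[jl ll _]; rewrite jl ll ltnn in lj.
- have /size0nil x10 : size x1 = 0.
    by move/(congr1 size): eL; rewrite !size_cat /=; lia.
  by move: eL; rewrite x10 /= => -[jE lE <-]; subst.
Qed.

(** Collecting a bracketed left-hand side must thus begin with its own rule, which is how a test
    word is recognized as a critical pair. *)
Lemma red_rule L R s e m : rule L R s -> normal_exps D e ->
  red D a act t L (nlet e) m ->
  exists2 m', red D a act t R (nlet e) m' & m = (act s 1%g + m')%R.
Proof.
move=> r he; move zE: (nlet e) => z rd.
case: {L z m} rd zE r => [w wE r|x1 L' R' s' x2 w m r' rd wE r].
  by case: (@rule_normal _ _ _ t e w R s [::] [::] he _ r); rewrite cats0.
have [x10 x20 eR es] := rule_minimal r r' erefl; subst.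
by exists m; rewrite ?wordev_nil //; move: rd; rewrite /= cats0.
Qed.

End FirstStep.

(** * From words with tail symbols to words with one total tail in [M] *)

Section CollectedTails.

Variables (n b p : nat) (D : pcpres n) (lab : labelling n b).
Variables (K : groupType) (a : 'I_n -> K) (Q : finGroupType) (pi : K -> Q).
Hypotheses (hD : pc_wf D) (ha : pc_rels D a).
Hypothesis pi_mul : forall x y, pi (x * y)%g = (pi x * pi y)%g.
Local Notation abar := (fun l => pi (a l)).
Local Notation A := (groupring 'F_p Q).
Local Notation Z := (freemod A (tails lab)).
Variables (M : zmodType) (actQ : M -> Q -> M) (hact : is_act actQ).
Variables (F : Z -> M) (hF : is_rlinear actQ F).

Definition kact (m : M) (x : K) : M := actQ m (pi x).

Lemma pi1 : pi 1%g = 1%g.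
Proof. by apply: (mulgI (pi 1%g)); rewrite -pi_mul !mulg1. Qed.

Lemma kact_is_act : is_act kact.
Proof.
split=> [m m' x|m|m x y]; rewrite /kact.
- exact: ractD.
- by rewrite pi1 ract1.
- by rewrite pi_mul (ractM hact).
Qed.

Definition otail (o : option (tails lab)) : M :=
  if o is Some x then F (zsingle x 1%R) else 0%R.
Definition rtail (j k : 'I_n) : M := otail (ytail lab j k).

Local Notation ev := (wordev a).
Local Notation red := (red D a kact rtail).
Local Notation rule := (rule D rtail).
Local Notation letter := (letter p lab Q).
Local Notation vw j k := (nlet (pcv D j k)).

Definition lgen_of (x : letter) : option 'I_n :=
  if x is Lgen l then Some l else None.

Definition gens (s : seq letter) : seq 'I_n := pmap lgen_of s.

(** The total tail once all symbols have been moved to the right end: each is acted on by the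
    generators behind it. *)
Fixpoint tail_of (s : seq letter) : M :=
  match s with
  | [::] => 0%R
  | Lgen _ :: s' => tail_of s'
  | Ltail x f :: s' => (kact (F (zsingle x f)) (ev (gens s')) + tail_of s')%R
  end.

Lemma gens_cat s s' : gens (s ++ s') = gens s ++ gens s'.
Proof. exact: pmap_cat. Qed.

Lemma tail_cat s s' :
  tail_of (s ++ s') = (kact (tail_of s) (ev (gens s')) + tail_of s')%R.
Proof.
have hk := kact_is_act.
elim: s => [|[l|x f] s IHs] /=; rewrite ?(ract0 hk) ?add0r //.
by rewrite IHs gens_cat wordev_cat (ractD hk) -(ractM hk) addrA.
Qed.

Lemma gens_cat3 s u s' : gens (s ++ u ++ s') = gens s ++ gens u ++ gens s'.
Proof. by rewrite !gens_cat. Qed.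

Lemma tail_cat3 s u s' : tail_of (s ++ u ++ s') =
  (kact (tail_of s) (ev (gens u ++ gens s')) +
    (kact (tail_of u) (ev (gens s')) + tail_of s'))%R.
Proof. by rewrite !tail_cat gens_cat. Qed.

Definition glet (w : seq 'I_n) : seq letter := [seq Lgen p lab Q l | l <- w].

Lemma gens_glet w : gens (glet w) = w.
Proof. by elim: w => //= l w ->. Qed.

Lemma tail_glet w : tail_of (glet w) = 0%R.
Proof. by elim: w. Qed.

Lemma nletters_glet e : nletters p lab Q e = glet (nlet e).
Proof.
rewrite /nletters /glet /nlet map_flatten -[in RHS]map_comp; congr flatten.
by apply: eq_map => l /=; rewrite map_nseq.
Qed.

Lemma nseq_glet k l : nseq k (Lgen p lab Q l) = glet (nseq k l).
Proof. by rewrite /glet map_nseq. Qed.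

Lemma gens_rhs j k : gens (rhs p D lab Q j k) = vw j k.
Proof.
rewrite /rhs gens_cat nletters_glet gens_glet.
by case: ytail => [x|] /=; rewrite cats0.
Qed.

Lemma tail_rhs j k : tail_of (rhs p D lab Q j k) = rtail j k.
Proof.
have hk := kact_is_act.
rewrite /rhs tail_cat nletters_glet tail_glet (ract0 hk) add0r /rtail /otail.
by case: ytail => [x|] //=; rewrite addr0 wordev_nil (ract1 hk).
Qed.

(** Swapping, merging and moving symbols change neither the generators nor the total tail; only the
    steps by a relation are steps of [red]. *)
Lemma cstep_red s s' : cstep D abar s s' ->
  exists2 m, red (gens s) (gens s') m & tail_of s' = (m + tail_of s)%R.
Proof.
have hk := kact_is_act.
case=> {s s'} [s s' x x' f f' _|s s' x f f'|s s' x f l|s s' l|s s' l j lj].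
- exists 0%R; first by rewrite !gens_cat; apply: Red0.
  by rewrite !tail_cat /= !wordev_nil !addr0 add0r [(kact (F (zsingle x' _)) _ + _)%R]addrC.
- exists 0%R; first by rewrite !gens_cat; apply: Red0.
  rewrite !tail_cat /= !wordev_nil !addr0 add0r zsingleD (rlinD hF) (ractD hk).
  by rewrite !(ract1 hk).
- exists 0%R; first by rewrite !gens_cat; apply: Red0.
  rewrite !tail_cat /= ?gens_cat /= !wordev_nil !addr0 add0r wordev1 (ract1 hk).
  by rewrite -zsingle_scale (rlinJ hF).
- exists (kact (rtail l l) (ev (gens s'))).
    rewrite !gens_cat3 gens_rhs nseq_glet gens_glet -[kact _ _]addr0.
    exact: RedS (Rpow _ _ _) (Red0 _ _ _ _ _).
  rewrite !tail_cat3 tail_rhs nseq_glet tail_glet gens_rhs gens_glet.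
  rewrite (ract0 hk) add0r addrCA; congr (_ + (kact _ _ + _))%R.
  by rewrite !wordev_cat -(rule_ev ha (Rpow D rtail l)).
- exists (kact (rtail l j) (ev (gens s'))).
    rewrite -cat_cons !gens_cat3 /= gens_rhs -[kact _ _]addr0.
    exact: RedS (Rconj _ _ lj) (Red0 _ _ _ _ _).
  rewrite -cat_cons !tail_cat3 /= tail_rhs gens_rhs.
  rewrite (ract0 hk) add0r addrCA; congr (_ + (kact _ _ + _))%R.
  have := congr1 (fun x => x * ev (gens s'))%g (rule_ev ha (Rconj D rtail lj)).
  by rewrite -!wordev_cat /= => ->.
Qed.

Lemma csteps_red s s' : clos_refl_trans _ (cstep D abar) s s' ->
  exists2 m, red (gens s) (gens s') m & tail_of s' = (m + tail_of s)%R.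
Proof.
elim=> {s s'} [s s' /cstep_red //|s|s s' s'' _ [m r e] _ [m' r' e']].
  by exists 0%R; rewrite ?add0r //; apply: Red0.
by exists (m + m')%R; [apply: red_trans r r' | rewrite e' e addrA [(m' + m)%R]addrC].
Qed.

Lemma gnormal_gens s e f : gnormal D s e f ->
  [/\ normal_exps D e, gens s = nlet e & tail_of s = F f].
Proof.
have hk := kact_is_act.
move=> [ys [he _ -> ->]].
have gys : gens [seq Ltail y.1 y.2 | y <- ys] = [::] by elim: ys.
split=> //; first by rewrite gens_cat gys cats0 nletters_glet gens_glet.
rewrite tail_cat nletters_glet tail_glet (ract0 hk) add0r.
have -> : [ffun x => \sum_(y <- ys | y.1 == x) y.2]%R =
    (\sum_(y <- ys) zsingle y.1 y.2)%R :> Z.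
  apply/ffunP=> x; rewrite ffunE sum_ffunE big_mkcond.
  by apply: eq_bigr => y _; rewrite ffunE eq_sym.
rewrite (rlin_sum hF); elim: ys gys => [|[x f'] ys IHys] gys /=; first by rewrite big_nil.
have {}gys : gens [seq Ltail y.1 y.2 | y <- ys] = [::] := gys.
by rewrite IHys // big_cons gys wordev_nil (ract1 hk).
Qed.

Lemma collects_red s e f c : collects D abar s e f c ->
  [/\ normal_exps D e, gens c = nlet e, tail_of c = F f &
      exists2 m, red (gens s) (nlet e) m & F f = (m + tail_of s)%R].
Proof.
move=> [/csteps_red[m r tE] /gnormal_gens[he ge te]]; split=> //.
by exists m; rewrite -?ge -?te.
Qed.

(** The bracket makes the rule on [L] the first step, so the rest is a collection of the reduct, as
    [joins] needs. *)
Lemma bcollects_rule w1 L w2 R s e f :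
  bcollects D abar (glet w1, glet L, glet w2) e f -> rule L R s ->
  normal_exps D e /\
  exists2 m, red (w1 ++ R ++ w2) (nlet e) m & F f = (kact s (ev w2) + m)%R.
Proof.
have hk := kact_is_act.
move=> [e' [f' [c' [c [/collects_red[he' gc' tc' [m rm mE]] /collects_red[he _ _ [k rk kE]]]]]]] r.
split=> //; rewrite /= !gens_cat ?gens_glet tail_glet addr0 in rm rk mE kE.
have [m' rm' mE'] := red_rule hD r he' rm.
rewrite gc' in rk.
exists (kact m' (ev w2) + k)%R.
  exact: (red_trans (red_ctx hk w1 w2 rm') rk).
rewrite kE !tail_cat !tail_glet gens_glet (ract0 hk) add0r addr0 tc' mE mE'.
by rewrite (ract1 hk) (ractD hk) addrC addrA.
Qed.

Lemma bcollects_red w1 L w2 e f :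
  bcollects D abar (glet w1, glet L, glet w2) e f ->
  normal_exps D e /\ red (w1 ++ L ++ w2) (nlet e) (F f).
Proof.
have hk := kact_is_act.
move=> [e' [f' [c' [c [/collects_red[_ gc' tc' [m rm mE]] /collects_red[he _ _ [k rk kE]]]]]]].
split=> //; rewrite /= !gens_cat ?gens_glet tail_glet addr0 in rm rk mE kE.
rewrite gc' in rk.
have -> : F f = (kact m (ev w2) + k)%R.
  by rewrite kE !tail_cat !tail_glet gens_glet (ract0 hk) add0r addr0 tc' mE addrC.
by apply: red_trans rk; apply: (red_ctx hk w1 w2 rm).
Qed.

(* The tests of [ctest] as pairs of bracketed words in the generators. *)
Inductive overlap : seq 'I_n -> seq 'I_n -> seq 'I_n -> seq 'I_n ->
    seq 'I_n -> seq 'I_n -> Prop :=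
| Overlap_conj (i j k : 'I_n) : i < j -> j < k ->
    overlap [::] [:: k; j] [:: i] [:: k] [:: j; i] [::]
| Overlap_powl (j k : 'I_n) : j < k ->
    overlap [::] (nseq (pcq D k) k) [:: j] (nseq (pcq D k).-1 k) [:: k; j] [::]
| Overlap_powr (i j : 'I_n) : i < j ->
    overlap [::] [:: j; i] (nseq (pcq D i).-1 i) [:: j] (nseq (pcq D i) i) [::]
| Overlap_pow (i : 'I_n) :
    overlap [::] (nseq (pcq D i) i) [:: i] [:: i] (nseq (pcq D i) i) [::].

Lemma ctest_overlap u u' : ctest D u u' -> exists x1 L x2 x1' L' x2',
  [/\ overlap x1 L x2 x1' L' x2', u = (glet x1, glet L, glet x2) &
      u' = (glet x1', glet L', glet x2')].
Proof.
case=> [i j k ij jk|j k jk|i j ij|i]; rewrite ?nseq_glet.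
- by do 6!eexists; split; [apply: (Overlap_conj ij jk) | |].
- by do 6!eexists; split; [apply: (Overlap_powl jk) | |].
- by do 6!eexists; split; [apply: (Overlap_powr ij) | |].
- by do 6!eexists; split; [apply: (Overlap_pow i) | |].
Qed.

Lemma overlap_ctest x1 L x2 x1' L' x2' : overlap x1 L x2 x1' L' x2' ->
  ctest D (glet x1, glet L, glet x2) (glet x1', glet L', glet x2').
Proof.
by case=> [i j k ij jk|j k jk|i j ij|i]; rewrite -?nseq_glet; constructor.
Qed.

Lemma overlap_word x1 L x2 x1' L' x2' : overlap x1 L x2 x1' L' x2' ->
  x1 ++ L ++ x2 = x1' ++ L' ++ x2'.
Proof.
have q1 l : nseq (pcq D l) l = l :: nseq (pcq D l).-1 l.
  by have := q_gt1 hD l; case: (pcq D l).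
case=> [i j k _ _|j k _|i j _|i] //=.
- by rewrite nseq_cat_cons q1.
- by rewrite q1 cats0.
- by rewrite nseq_cat_cons.
Qed.

Lemma ctest_value_red u u' z : ctest D u u' -> ctest_value D abar u u' z ->
  exists w e f f', [/\ normal_exps D e, red w (nlet e) (F f),
    red w (nlet e) (F f') & F z = actQ (F f - F f')%R (nword abar e)^-1%g].
Proof.
move=> /ctest_overlap[x1 [L [x2 [x1' [L' [x2' [o -> ->]]]]]]].
move=> [e [f [f' [/bcollects_red[he r] /bcollects_red[_ r'] ->]]]].
exists (x1 ++ L ++ x2), e, f, f'; split=> //; first by rewrite (overlap_word o).
by rewrite (rlinJ hF) (rlinD hF) (rlinN hF).
Qed.

Variable T : Z -> Prop.
Hypotheses (hT : ctest_set D abar T) (FT : forall z, T z -> F z = 0%R).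

Lemma overlap_joins x1 L R s x2 x1' L' R' s' x2' :
  overlap x1 L x2 x1' L' x2' -> rule L R s -> rule L' R' s' ->
  joins D a kact rtail x1 R s x2 x1' R' s' x2'.
Proof.
have hk := kact_is_act; move=> o r r'; have [_ tT] := hT.
have [z Tz [e [f [f' [cf cf' zE]]]]] := tT _ _ (overlap_ctest o).
have [he [m rm mE]] := bcollects_rule cf r.
have [_ [m' rm' mE']] := bcollects_rule cf' r'.
exists (nlet e), m, m'; split=> //; rewrite -mE -mE'; apply/eqP.
rewrite -subr_eq0; move: (FT Tz).
(* The test value carries the inverse of the value of the normal word; acting with that value
   removes it. *)
rewrite zE (rlinJ hF) (rlinD hF) (rlinN hF) => /(congr1 (actQ^~ (nword abar e))).
by rewrite -(ractM hact) mulVg (ract1 hact) (ract0 hact) => ->.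
Qed.

Theorem tests_confluent w m m' :
  nfv D a kact rtail w m -> nfv D a kact rtail w m' -> m = m'.
Proof.
apply: (red_confluent hD ha kact_is_act) => [i j k ij jk|j k jk|i j ij|i].
- by apply: overlap_joins (Overlap_conj ij jk) _ _; apply: Rconj.
- by apply: overlap_joins (Overlap_powl jk) _ _; [apply: Rpow | apply: Rconj].
- by apply: overlap_joins (Overlap_powr ij) _ _; [apply: Rconj | apply: Rpow].
- by apply: overlap_joins (Overlap_pow i) _ _; apply: Rpow.
Qed.

End CollectedTails.

(** * Definitions of the generators *)

Section TailSubgroups.

Variables (n : nat) (D : pcpres n) (K : finGroupType) (a : 'I_n -> K).
Hypotheses (hD : pc_wf D) (ha : pc_rels D a) (hcons : consistent D a).

Lemma tailgrp_word l x : tailgrp a l x ->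
  exists2 w : seq 'I_n, forall k, k \in w -> l <= k & wordev a w = x.
Proof.
pose B x := exists2 w : seq 'I_n, forall k, k \in w -> l <= k & wordev a w = x.
have B1 : B 1%g by exists [::]; rewrite ?wordev_nil.
have BM y z : B y -> B z -> B (y * z)%g.
  move=> [w hw <-] [w' hw' <-]; exists (w ++ w'); last by rewrite wordev_cat.
  by move=> k; rewrite mem_cat => /orP[/hw|/hw'].
move=> tx; apply: (tx B) => [|_ [k lk ->]]; last first.
  by exists [:: k]; rewrite ?wordev1 // => k'; rewrite inE => /eqP->.
(* In a finite group inverses are positive powers, so words without inverse letters suffice. *)
split=> // y By; rewrite invg_expg; elim: (#[y]%g.-1) => [|k IHk] //.
by rewrite expgS; apply: BM.
Qed.

Lemma tailgrp_support l e : normal_exps D e -> tailgrp a l (nword a e) ->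
  forall k, e k != 0 -> l <= k.
Proof.
move=> he /tailgrp_word[w hw wE] k ek.
(* Only the normal word matters here, so collection is run with zero tails in a trivial module. *)
pose act (m : int) (_ : K) := m; pose t (_ _ : 'I_n) : int := 0%R.
have [m [e' he' r]] := nfv_ex a hD act t w.
have [e'' [_ ue]] := hcons (nword a e).
have e'E : e' = e.
  rewrite -(ue e (conj he erefl)); apply/esym/ue; split=> //.
  by rewrite -wE (red_ev ha r) wordev_nlet.
by apply: (red_geq hD r hw); rewrite e'E mem_nlet.
Qed.

Lemma tailgrp_gen l k : tailgrp a l (a k) <-> l <= k.
Proof.
split=> [alk|lk]; last by apply: gen_incl; exists k.
apply: (@tailgrp_support l (exps1 k)); last by rewrite ffunE eqxx.
  by move=> j; rewrite ffunE; case: eqP => _; [apply: q_gt1 | apply: q_gt0].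
by rewrite -wordev_nlet nlet1 wordev1.
Qed.

End TailSubgroups.

(* The left-hand side of the relation (j, k). *)
Definition pclhs (n : nat) (D : pcpres n) (X : groupType) (al : 'I_n -> X) (j k : 'I_n) : X :=
  (if j == k then al k ^+ pcq D k else al k ^ al j)%g.

Lemma mor_pclhs n (D : pcpres n) (X Y : groupType) (f : {multiplicative X -> Y})
    (al : 'I_n -> X) j k : f (pclhs D al j k) = pclhs D (f \o al) j k.
Proof. by rewrite /pclhs; case: eqP => _; rewrite ?morX ?morJ. Qed.

Lemma pclhs_rels n (D : pcpres n) (X : groupType) (al : 'I_n -> X) (j k : 'I_n) :
  pc_rels D al -> j <= k -> pclhs D al j k = nword al (pcv D j k).
Proof.
move=> [apow aconj]; rewrite leq_eqVlt /pclhs => /predU1P[/val_inj->|jk].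
  by rewrite eqxx.
by rewrite ifN ?aconj // neq_ltn jk.
Qed.

(** * Solving the definitions for the generators *)

Section Definitions.

Variables (n b : nat) (D : pcpres n) (lab : labelling n b) (w : 'I_b -> exps n).

(* The definition of a_k reads [dlhs k = dexp k]. *)
Definition dexp (k : 'I_n) : exps n :=
  if k \in lset lab then w (lgen lab k) else pcv D (ldef lab k).1 (ldef lab k).2.

Definition dlhs (X : groupType) (g : 'I_b -> X) (al : 'I_n -> X) (k : 'I_n) : X :=
  if k \in lset lab then g (lgen lab k)
  else pclhs D al (ldef lab k).1 (ldef lab k).2.

Definition defined (X : groupType) (g : 'I_b -> X) (al : 'I_n -> X) (k : 'I_n) :=
  dlhs g al k = nword al (dexp k).

Definition def_rank (mu : 'I_n -> nat) : Prop := forall k,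
  (k \notin lset lab -> mu (ldef lab k).1 < mu k /\ mu (ldef lab k).2 < mu k) /\
  forall l, l != k -> dexp k l != 0 -> mu l < mu k.

Section Rank.

Variables (mu : 'I_n -> nat) (hmu : def_rank mu).
Hypothesis hlast : forall k, last_gen (dexp k) k.
Variables (X : groupType) (g : 'I_b -> X).
Implicit Types al be : 'I_n -> X.

Let dexp' k : exps n := [ffun l => if l == k then 0 else dexp k l].

Lemma dlhs_agree al be k :
  (forall l, mu l < mu k -> al l = be l) -> dlhs g al k = dlhs g be k.
Proof.
move=> eq_ab; rewrite /dlhs; case: ifPn => // /(hmu k).1[/eq_ab e1 /eq_ab e2].
by rewrite /pclhs e1 e2.
Qed.

Lemma dexp_agree al be k :
  (forall l, mu l < mu k -> al l = be l) -> nword al (dexp' k) = nword be (dexp' k).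
Proof.
move=> eq_ab; apply: nword_support => l; rewrite ffunE.
by case: (eqVneq l k) => // lk ek; apply: eq_ab; apply: (hmu k).2.
Qed.

Lemma defined_agree al be k :
  (forall l, mu l <= mu k -> al l = be l) -> defined g al k -> defined g be k.
Proof.
move=> eq_ab; have eq_ab' l : mu l < mu k -> al l = be l by move=> /ltnW/eq_ab.
rewrite /defined (dlhs_agree eq_ab') => ->.
by rewrite !(nword_last _ (hlast k)) (dexp_agree eq_ab') eq_ab.
Qed.

(** By induction on the rank, everything in the definition except its last factor [al k] is already
    determined. *)
Lemma defined_unique al be :
  (forall k, defined g al k) -> (forall k, defined g be k) -> al =1 be.
Proof.
move=> dal dbe k; have [N] := ubnP (mu k); elim: N k => // N IHN k kN.
have eq_ab l : mu l < mu k -> al l = be l.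
  by move=> lk; apply: IHN; apply: leq_trans lk _.
apply: (mulgI (nword al (dexp' k))); rewrite -nword_last // -dal.
by rewrite (dexp_agree eq_ab) -nword_last // -dbe; apply: dlhs_agree.
Qed.

Variables (K : groupType) (a : 'I_n -> K) (phi : {multiplicative X -> K}).
Hypotheses (hphi : surj phi) (hdef : forall k, defined (phi \o g) a k).

Lemma mor_dlhs al k : phi (dlhs g al k) = dlhs (phi \o g) (phi \o al) k.
Proof. by rewrite /dlhs; case: ifP => // _; rewrite mor_pclhs. Qed.

(** Arbitrary lifts are corrected rank by rank. Solving a definition for its generator leaves
    smaller ranks untouched, and yields a lift again because the definition holds in [K]. *)
Lemma defined_exists :
  exists2 al, forall k, phi (al k) = a k & forall k, defined g al k.
Proof.
suff [al lift_al dal] : exists2 al : 'I_n -> X, forall k, phi (al k) = a k &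
    forall k, mu k < (\max_(k < n) mu k).+1 -> defined g al k.
  by exists al => // k; apply: dal; rewrite ltnS leq_bigmax.
elim: _.+1 => [|m [al lift_al dal]].
  have /choice[al lift_al] : forall k, exists x, phi x = a k by move=> k; apply: hphi.
  by exists al.
pose be k := if mu k == m then ((nword al (dexp' k))^-1 * dlhs g al k)%g else al k.
have be_al k l : mu k <= m -> mu l < mu k -> al l = be l.
  by move=> km lk; rewrite /be ifN // neq_ltn (leq_trans lk km).
have phi_al : phi \o al = a by apply: functional_extensionality_dep.
exists be => k; last first.
  rewrite ltnS leq_eqVlt => /predU1P[km|km].
    rewrite /defined (nword_last _ (hlast k)) -/(dexp' k).
    rewrite -(dexp_agree (be_al k^~ _)) ?km // -(dlhs_agree (be_al k^~ _)) ?km //.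
    by rewrite /be km eqxx mulVKg.
  apply: defined_agree (dal k km) => l lk.
  by rewrite /be ifN // neq_ltn (leq_ltn_trans lk km).
rewrite /be; case: ifP => // _.
rewrite gmulfM morV mor_nword mor_dlhs phi_al hdef.
by rewrite (nword_last _ (hlast k)) mulKg.
Qed.

End Rank.

End Definitions.

Section DefinitionRank.

Variables (n b : nat) (D : pcpres n) (lab : labelling n b) (w : 'I_b -> exps n).
Variables (K : finGroupType) (a : 'I_n -> K) (L : seq (nat * nat)).
Hypotheses (hD : pc_wf D) (ha : pc_rels D a) (hcons : consistent D a).
Hypotheses (href : refines L a) (hlab : labelled_pres D lab a).
Hypothesis hepi : labelled_epi lab L a w.

Lemma dexp_last k : last_gen (dexp D lab w k) k.
Proof.
have [_ _ ldefP _] := hlab; rewrite /dexp; case: ifPn => [kX|/ldefP[]//].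
by have [] := hepi kX.
Qed.

Definition is_Lindex (l : nat) : Prop :=
  exists i j, Lindex L i j /\ forall x : K, Lterm L i j x <-> tailgrp a l x.

(* The layer of a_k is the start of the last term of the series containing a_k. *)
Definition layer (k : 'I_n) : nat :=
  \max_(l < n.+1 | (l <= k) && `[< is_Lindex l >]) l.

Lemma layer_leq k : layer k <= k.
Proof. by apply/bigmax_leqP=> l /andP[]. Qed.

Lemma leq_layer l (k : 'I_n) : is_Lindex l -> l <= k -> l <= layer k.
Proof.
move=> Ll lk; have ln : l < n.+1 by apply: leq_trans lk (ltnW (ltn_ord k)).
by apply: (leq_bigmax_cond (Ordinal ln)) => /=; rewrite lk; apply/asboolP.
Qed.

Lemma layer_mono (k k' : 'I_n) :
  (forall l, is_Lindex l -> l <= k -> l <= k') -> layer k <= layer k'.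
Proof.
by move=> kk'; apply/bigmax_leqP=> l /andP[lk /asboolP Ll]; apply: leq_layer; auto.
Qed.

(* The definition of a_k involves no generator of a later layer, because the
   terms of the series are normal; if a_k is in X, even only a_k and generators
   of earlier layers.  Ties are broken by the ranking of the presentation. *)
Lemma def_rank_exists : exists mu, def_rank D lab w mu.
Proof.
have [_ _ ldefP [rk rkP]] := hlab.
(* [B] exceeds all values of [rk], so [layer k * B + rk k] orders lexicographically by layer and
   then by [rk]. *)
pose B := (\max_(k < n) rk k).+1.
have rkB k : rk k < B by rewrite ltnS leq_bigmax.
have lt_rank x y (k l : 'I_n) : x < y -> x * B + rk k < y * B + rk l.
  move=> xy; have := rkB k; have := leq_mul xy (leqnn B); rewrite mulSn; lia.
exists (fun k => layer k * B + rk k) => k; split=> [kX|l lk].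
  have [jk [vk v0]] := ldefP k kX; have [rk1 rk2 _] := rkP k kX.
  have mu_lt l : layer l <= layer k -> rk l < rk k ->
      layer l * B + rk l < layer k * B + rk k.
    by move=> le_l lt_rk; rewrite -addnS leq_add ?leq_mul.
  have [_ vN vZ] := hD.
  have jlt : (ldef lab k).1 < k.
    by rewrite ltnNge; apply: contra_eqN vk => kj; rewrite vZ.
  split; apply: mu_lt => //; apply: layer_mono => l Ll le_l.
    exact: leq_trans le_l (ltnW jlt).
  have [i [j [_ LE]]] := Ll.
  (* A normal term containing the generator on the left-hand side contains the right-hand side too,
     and [a k] occurs in that normal word. *)
  apply: (tailgrp_support hD ha hcons (vN _ _ jk)); last by rewrite vk.
  rewrite -(pclhs_rels ha jk); apply/LE.
  have : Lterm L i j (a (ldef lab k).2) by apply/LE/(tailgrp_gen hD ha hcons).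
  rewrite /pclhs; case: eqP => _ La; last exact: Lterm_conj.
  by apply: subgroupX La; apply: Lterm_subgroup.
rewrite /dexp; case: ifPn => kX ekl.
  apply: lt_rank; have [_ [i [j [[Lij Lk _] onlyk]]]] := hepi kX.
  have [l' l'n LE] := href Lij.
  have l'k : l' <= k by apply/(tailgrp_gen hD ha hcons)/LE.
  have Ll' : is_Lindex l' by exists i, j.
  (* The term starting at [l'] contains [a k] but not [a l], whence [l < l' <= layer k]. *)
  apply: leq_trans (leq_layer Ll' l'k); apply: leq_ltn_trans (layer_leq l) _.
  rewrite ltnNge; apply: contra lk => l'l; apply/eqP/onlyk => //.
  exact/LE/(tailgrp_gen hD ha hcons).
have [_ _ /(_ l lk ekl) lt_rk] := rkP k kX; have [_ [_ v0]] := ldefP k kX.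
have le_lk : l <= k by rewrite leqNgt; apply: contra ekl => /v0/eqP.
rewrite -addnS leq_add ?leq_mul //; apply: layer_mono => l' _ l'l.
exact: leq_trans l'l le_lk.
Qed.

End DefinitionRank.

Section MorphismsOfWords.

Variables (X Y : groupType) (f : {multiplicative X -> Y}).

Lemma mor_weval (I : Type) (h : I -> X) s : f (weval h s) = weval (f \o h) s.
Proof.
rewrite /weval mor_prod; apply: eq_bigr => x _.
by case: ifP => _ //; rewrite morV.
Qed.

Lemma mor_sigma n b (lab : labelling n b) (h : 'I_n + tails lab -> X) w l :
  f (sigma h w l) = sigma (f \o h) w l.
Proof.
rewrite /sigma gmulfM /agen mor_nword; congr (_ * _)%g.
by rewrite /otgen; case: ztail => [x|] //; rewrite mor1.
Qed.

Lemma mor_mod_eval n b p (lab : labelling n b) (Q : finGroupType)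
    (sec : Q -> exps n) (h : 'I_n + tails lab -> X)
    (z : freemod (groupring 'F_p Q) (tails lab)) :
  f (mod_eval sec h z) = mod_eval sec (f \o h) z.
Proof.
rewrite /mod_eval mor_prod; apply: eq_bigr => x _.
rewrite mor_prod; apply: eq_bigr => c _.
by rewrite morX morJ mor_nword.
Qed.

Lemma eq_weval (I : Type) (h h' : I -> X) s : h =1 h' -> weval h s = weval h' s.
Proof. by move=> eq_h; apply: eq_bigr => x _; rewrite eq_h. Qed.

Lemma mor_eq_on_gens (I : Type) (g : I -> X) (f' : {multiplicative X -> Y}) :
  (forall x, gen (fun y => exists k, y = g k) x) ->
  (forall k, f (g k) = f' (g k)) -> f =1 f'.
Proof.
move=> gg eq_g x; apply: (gg x (fun x => f x = f' x)) => [|_ [k ->] //].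
split=> [|u v eu ev|u eu]; first by rewrite !mor1.
  by rewrite !gmulfM eu ev.
by rewrite !morV eu.
Qed.

End MorphismsOfWords.

Lemma mor_factor (X Y Z : groupType) (f : {multiplicative X -> Y})
    (g : {multiplicative X -> Z}) :
  surj f -> (forall x, f x = 1%g -> g x = 1%g) ->
  exists f' : {multiplicative Y -> Z}, forall x, f' (f x) = g x.
Proof.
move=> sf kfg; have /choice[s sK] := sf.
have gE x x' : f x = f x' -> g x = g x'.
  move=> eq_f; apply: divg1_eq; rewrite -morF; apply: kfg.
  by rewrite morF eq_f mulgV.
pose f0 y := g (s y).
have f0M : {morph f0 : x y / (x * y)%g}.
  by move=> x y; rewrite /f0 -gmulfM; apply: gE; rewrite gmulfM !sK.
pose f' : {multiplicative Y -> Z} :=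
  HB.pack f0 (isMultiplicative.Build Y Z f0 f0M).
by exists f' => x; apply: gE; rewrite sK.
Qed.

Section Tails.

Variables (n b : nat) (D : pcpres n) (lab : labelling n b).

Lemma ytailP (j k : 'I_n) : j <= k ->
  (exists2 u : yidx lab, val u = (j, k) & ytail lab j k = Some (inl u)) \/
  (ytail lab j k = None /\ exists2 k', k' \notin lset lab & ldef lab k' = (j, k)).
Proof.
move=> jk; rewrite /ytail; case: insubP => [u _ uE|]; first by left; exists u.
rewrite /nondef_rel jk /= negb_forall => /existsP[k'].
by rewrite negb_imply negbK => /andP[k'X /eqP kE]; right; split=> //; exists k'.
Qed.

Lemma ytail_val (u : yidx lab) : ytail lab (val u).1 (val u).2 = Some (inl u).
Proof. by rewrite /ytail -surjective_pairing valK. Qed.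

Lemma yidx_leq (u : yidx lab) : (val u).1 <= (val u).2.
Proof. by have /andP[] := valP u. Qed.

Lemma ytail_def k : k \notin lset lab ->
  ytail lab (ldef lab k).1 (ldef lab k).2 = None.
Proof.
move=> kX; rewrite /ytail -surjective_pairing insubF // /nondef_rel.
apply/negbTE; rewrite negb_and; apply/orP; right; rewrite negb_forall.
by apply/existsP; exists k; rewrite kX eqxx.
Qed.

Lemma ztailP (l : 'I_b) :
  (exists2 u : zidx lab, val u = l & ztail lab l = Some (inr u)) \/
  (ztail lab l = None /\ exists2 k, k \in lset lab & lgen lab k = l).
Proof.
rewrite /ztail; case: insubP => [u _ uE|]; first by left; exists u.
rewrite /nondef_gen negb_forall => /existsP[k].
by rewrite negb_imply negbK => /andP[kX /eqP kE]; right; split=> //; exists k.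
Qed.

Lemma ztail_val (u : zidx lab) : ztail lab (val u) = Some (inr u).
Proof. by rewrite /ztail valK. Qed.

Lemma ztail_def k : k \in lset lab -> ztail lab (lgen lab k) = None.
Proof.
move=> kX; rewrite /ztail insubF // /nondef_gen.
by apply/negbTE; rewrite negb_forall; apply/existsP; exists k; rewrite kX eqxx.
Qed.

End Tails.

(** * Realizing the relations with tails in an extension *)

Section Realization.

Variables (n b p : nat) (D : pcpres n) (lab : labelling n b).
Variables (K : finGroupType) (a : 'I_n -> K) (Q : finGroupType) (pi : K -> Q).
Hypotheses (hD : pc_wf D) (ha : pc_rels D a) (hcons : consistent D a).
Hypothesis pi_mul : forall x y, pi (x * y)%g = (pi x * pi y)%g.
Local Notation Z := (freemod (groupring 'F_p Q) (tails lab)).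
Variables (M : zmodType) (actQ : M -> Q -> M) (hact : is_act actQ).
Variables (F : Z -> M) (hF : is_rlinear actQ F).
Variables (X : groupType) (pr : {multiplicative X -> K}).
Variables (io : M -> X) (al : 'I_n -> X).
Hypothesis ioD : forall m m', io (m + m')%R = (io m * io m')%g.
Hypothesis ioJ : forall m x, (io m ^ x)%g = io (actQ m (pi (pr x))).
Hypothesis pr_io : forall m, pr (io m) = 1%g.
Hypothesis pr_al : forall l, pr (al l) = a l.
Hypothesis al_rel : forall j k : 'I_n, j <= k ->
  pclhs D al j k = (nword al (pcv D j k) * io (rtail F j k))%g.

Local Notation kact := (kact pi actQ).

Definition real_gens (k : 'I_n + tails lab) : X :=
  match k with inl l => al l | inr x => io (F (zsingle x 1%R)) end.

Lemma io0 : io 0%R = 1%g.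
Proof. by apply: (mulgI (io 0%R)); rewrite -ioD addr0 mulg1. Qed.

Lemma ioN m : io (- m)%R = ((io m)^-1)%g.
Proof. by apply: (mulgI (io m)); rewrite -ioD subrr io0 mulgV. Qed.

Lemma ioMn m k : io (m *+ k)%R = (io m ^+ k)%g.
Proof. by elim: k => [|k IHk]; rewrite ?mulr0n ?io0 // mulrS expgS ioD IHk. Qed.

Lemma io_sum (I : Type) (r : seq I) (P : pred I) G :
  io (\sum_(k <- r | P k) G k)%R = (\prod_(k <- r | P k) io (G k))%g.
Proof. by elim/big_rec2: _ => [|k y x _ <-]; rewrite ?io0 ?ioD. Qed.

Lemma pr_nword e : pr (nword al e) = nword a e.
Proof. by rewrite mor_nword; apply: nword_support => l _; apply: pr_al. Qed.

Lemma pr_wordev w : pr (wordev al w) = wordev a w.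
Proof. by rewrite mor_wordev; apply: eq_bigr => l _; apply: pr_al. Qed.

Lemma io_otail o : otgen real_gens o = io (otail F o).
Proof. by case: o => [x|] //=; rewrite io0. Qed.

Lemma real_sigma w l :
  sigma real_gens w l = (nword al (w l) * io (otail F (ztail lab l)))%g.
Proof. by rewrite /sigma io_otail. Qed.

Lemma real_ext_rels r : (forall m : M, m *+ p = 0)%R ->
  (forall l : 'I_n, r <= l -> pi (a l) = 1%g) -> ext_rels D real_gens p r.
Proof.
move=> tors abar1; split=> [l|j k jk|x x' e _ _|x|x l rl].
- by rewrite io_otail; have := al_rel (leqnn l); rewrite /pclhs eqxx.
- by rewrite io_otail; have := al_rel (ltnW jk); rewrite /pclhs ifN // neq_ltn jk.
- rewrite /tgen /= ioJ; apply/eqP/commgP.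
  by rewrite /commute -!ioD addrC.
- by rewrite /tgen /= -ioMn tors io0.
- by rewrite /tgen /agen /= ioJ pr_al abar1 // (ract1 hact).
Qed.

Lemma real_mod_eval r sec z : transversal_words D (fun l => pi (a l)) r sec ->
  mod_eval sec real_gens z = io (F z).
Proof.
move=> hsec; rewrite (rlin_decomp hF) io_sum; apply: eq_bigr => x _.
rewrite io_sum; apply: eq_bigr => c _; rewrite ioMn /tgen /= ioJ.
congr (io (actQ _ _) ^+ _)%g; have [_ _ {2}<-] := hsec c.
rewrite -[agen real_gens]/al pr_nword -!wordev_nlet; elim: (nlet _) => [|l w IHw].
  by rewrite !wordev_nil (pi1 pi_mul).
by rewrite !wordev_cons pi_mul IHw.
Qed.

(** Moving a tail to the right past [x2] is conjugation in [X], which [ioJ] turns into the module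
    action. *)
Lemma real_red w w' m : red D a kact (rtail F) w w' m ->
  wordev al w = (wordev al w' * io m)%g.
Proof.
elim=> [{}w|x1 L R s x2 {}w {}m r _ IH]; first by rewrite io0 mulg1.
have -> : wordev al (x1 ++ L ++ x2) =
    (wordev al (x1 ++ R ++ x2) * io (kact s (wordev a x2)))%g.
  have eLR : wordev al L = (wordev al R * io s)%g.
    case: r => [l|l j lj].
      by have := al_rel (leqnn l); rewrite wordev_nseq wordev_nlet /pclhs eqxx.
    have := al_rel (ltnW lj); rewrite /pclhs ifN ?neq_ltn ?lj // => e.
    by rewrite !wordev_cons wordev_nil mulg1 wordev_nlet -mulgA -e conjgE mulVKg.
  rewrite !wordev_cat eLR -!mulgA -pr_wordev -ioJ conjgE.
  by rewrite mulVKg.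
rewrite IH -mulgA -ioD; congr (_ * io _)%g; exact: addrC.
Qed.

Lemma red_image w w' m : red D a kact (rtail F) w w' m -> exists z, m = F z.
Proof.
elim=> [_|x1 L R s x2 {}w {}m r _ [z ->]]; first by exists 0%R; rewrite (rlin0 hF).
have [z' ->] : exists z, s = F z.
  suff rt j k : exists z, rtail F j k = F z by case: r => *; apply: rt.
  rewrite /rtail; case: ytail => [x|] /=; first by exists (zsingle x 1%R).
  by exists 0%R; rewrite (rlin0 hF).
exists (rscale z' (gr_elt 'F_p (pi (wordev a x2))) + z)%R.
by rewrite (rlinD hF) (rlinJ hF).
Qed.

Lemma exps0_uniq e : normal_exps D e -> nword a e = 1%g -> e = exps0 n.
Proof.
move=> he e1; have [e' [_ ue]] := hcons 1%g.
rewrite -(ue e) //; apply: ue; split; first by move=> l; rewrite ffunE (q_gt0 hD).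
by rewrite -wordev_nlet nlet0 wordev_nil.
Qed.

(* Products of a word in the [al l] and an element of the image of F; they form
   a subgroup because a power of [al l] lying over 1 is in that image. *)
Definition collected (x : X) : Prop :=
  exists w z, x = (wordev al w * io (F z))%g.

Lemma collectedM x y : collected x -> collected y -> collected (x * y)%g.
Proof.
move=> [w [z ->]] [w' [z' ->]]; exists (w ++ w').
exists (rscale z (gr_elt 'F_p (pi (wordev a w'))) + z')%R.
rewrite (rlinD hF) (rlinJ hF) ioD wordev_cat -pr_wordev -ioJ conjgE.
by rewrite !mulgA mulgK.
Qed.

(** Collection leaves a normal word times a tail; over 1 the normal word is empty by consistency. *)
Lemma collected_ker x : collected x -> pr x = 1%g -> exists z, x = io (F z).
Proof.
move=> [w [z ->]]; have [m [e he r]] := nfv_ex a hD kact (rtail F) w.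
have [z' mE] := red_image r; rewrite (real_red r) mE -mulgA -ioD -(rlinD hF).
rewrite gmulfM pr_io mulg1 wordev_nlet pr_nword => /(exps0_uniq he) ->.
by exists (z' + z)%R; rewrite -wordev_nlet nlet0 wordev_nil mul1g.
Qed.

Lemma collected_word w : collected (wordev al w).
Proof. by exists w, 0%R; rewrite (rlin0 hF) io0 mulg1. Qed.

Lemma collected_io z : collected (io (F z)).
Proof. by exists [::], z; rewrite wordev_nil mul1g. Qed.

Lemma collected_subgroup : is_subgroup collected.
Proof.
split; [by rewrite -io0 -(rlin0 hF); apply: collected_io | exact: collectedM |].
have al_inv l : collected (al l)^-1%g.
  have [z zE] : exists z, wordev al (nseq #[a l]%g l) = io (F z).
    apply: collected_ker; first exact: collected_word.
    by rewrite pr_wordev wordev_nseq expg_order.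
  have -> : ((al l)^-1 = wordev al (nseq #[a l].-1 l) * io (F (- z)%R))%g.
    rewrite (rlinN hF) ioN -zE !wordev_nseq -{2}(prednK (order_gt0 (a l))).
    by rewrite expgS invgM mulVKg.
  by exists (nseq #[a l]%g.-1 l), (- z)%R.
move=> _ [w [z ->]]; rewrite invgM -ioN -(rlinN hF).
apply: collectedM (collected_io _) _.
elim: w => [|l w IHw]; first by rewrite wordev_nil invg1 -(wordev_nil al); apply: collected_word.
by rewrite wordev_cons invgM; apply: collectedM.
Qed.

(** The images of the generators are collected elements, and these form a subgroup, hence all of
    [X]. *)
Lemma real_generated (w : 'I_b -> exps n) :
  (forall x, gen (fun y => exists l, y = sigma real_gens w l) x) ->
  forall x, pr x = 1%g -> exists z, x = io (F z).
Proof.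
move=> gX x; apply: collected_ker; apply: (gX x) collected_subgroup _ => _ [l ->].
rewrite real_sigma -wordev_nlet; apply: collectedM (collected_word _) _.
case: ztail => [u|] /=; first exact: collected_io.
by rewrite -(rlin0 hF); apply: collected_io.
Qed.

(** The universal property maps the extended group to [X], taking its tail symbols to the realized
    tails. Any representative [z] of the relator's value in [Kt] therefore yields its value in
    [X]. *)
Lemma real_relator m (rel : 'I_m -> seq ('I_b * bool)) w r sec (Kt : groupType)
    (h : 'I_n + tails lab -> Kt) l z :
  presents (fun H' h' => ext_rels D h' p r) h ->
  (forall m : M, m *+ p = 0)%R ->
  (forall l : 'I_n, r <= l -> pi (a l) = 1%g) ->
  transversal_words D (fun l => pi (a l)) r sec ->
  weval (sigma h w) (rel l) = mod_eval sec h z ->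
  weval (sigma real_gens w) (rel l) = io (F z).
Proof.
move=> [_ _ univ] tors abar1 hsec relE.
have [f fE] := univ X real_gens (real_ext_rels tors abar1).
have {}fE : f \o h = real_gens by apply: functional_extensionality_dep.
rewrite -(real_mod_eval z hsec) -fE -mor_mod_eval -relE mor_weval.
by apply: eq_weval => l'; rewrite /= mor_sigma.
Qed.

End Realization.

(** * An abelian kernel as a module *)

Section KernelModule.

Variables (X K : groupType) (pr : {multiplicative X -> K}).

Definition abelian_kernel : Prop :=
  forall x y, pr x = 1%g -> pr y = 1%g -> (x * y = y * x)%g.

Definition kermod (hab : abelian_kernel) : Type := {x : X | pr x == 1%g}.

Variable hab : abelian_kernel.
Local Notation N := (kermod hab).

HB.instance Definition _ := Choice.copy N {x : X | pr x == 1%g}.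

Definition kval (x : N) : X := sval x.

Lemma kval_inj : injective kval.
Proof. exact: val_inj. Qed.

Lemma pr_kval (x : N) : pr (kval x) = 1%g.
Proof. by apply/eqP; case: x. Qed.

Definition kmk (x : X) (hx : pr x = 1%g) : N := exist _ x (introT eqP hx).

Fact ker_add_subproof (x y : N) : pr (kval x * kval y)%g = 1%g.
Proof. by rewrite gmulfM !pr_kval mulg1. Qed.

Fact ker_opp_subproof (x : N) : pr (kval x)^-1%g = 1%g.
Proof. by rewrite morV pr_kval invg1. Qed.

Definition ker_add x y : N := kmk (ker_add_subproof x y).
Definition ker_opp x : N := kmk (ker_opp_subproof x).
Definition ker_zero : N := kmk (mor1 pr).

Fact ker_addA : associative ker_add.
Proof. by move=> x y z; apply: kval_inj; rewrite /= mulgA. Qed.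

Fact ker_addC : commutative ker_add.
Proof. by move=> x y; apply: kval_inj; rewrite /=; apply: hab; apply: pr_kval. Qed.

Fact ker_add0 : left_id ker_zero ker_add.
Proof. by move=> x; apply: kval_inj; rewrite /= mul1g. Qed.

Fact ker_addN : left_inverse ker_zero ker_opp ker_add.
Proof. by move=> x; apply: kval_inj; rewrite /= mulVg. Qed.

HB.instance Definition _ := GRing.isZmodule.Build N ker_addA ker_addC ker_add0 ker_addN.

Lemma kvalD (x y : N) : kval (x + y)%R = (kval x * kval y)%g.
Proof. by []. Qed.

Variables (Q : finGroupType) (pi : K -> Q) (s : Q -> X).
Hypothesis pi_mul : forall x y, pi (x * y)%g = (pi x * pi y)%g.
Hypothesis sK : forall c, pi (pr (s c)) = c.
Hypothesis hcent : forall x y, pr x = 1%g -> pi (pr y) = 1%g -> (x ^ y)%g = x.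

Fact keract_subproof (x : N) c : pr (kval x ^ s c)%g = 1%g.
Proof. by rewrite morJ pr_kval conj1g. Qed.

Definition keract (x : N) (c : Q) : N := kmk (keract_subproof x c).

(** Elements with the same image in [Q] differ by one that centralizes the kernel, so the
    representatives [s] do not matter. *)
Lemma keractE x y : kval (keract x (pi (pr y))) = (kval x ^ y)%g.
Proof.
have piV u : pi (u^-1)%g = (pi u)^-1%g.
  by apply: (mulgI (pi u)); rewrite -pi_mul !mulgV (pi1 pi_mul).
rewrite -[y in RHS](mulVKg (s (pi (pr y)))) conjgM hcent //.
  by rewrite morJ pr_kval conj1g.
by rewrite gmulfM morV pi_mul piV sK mulVg.
Qed.

Lemma keract_is_act : is_act keract.
Proof.
split=> [x y c|x|x c d]; apply: kval_inj.
- by rewrite kvalD -{1 2 3}(sK c) !keractE kvalD conjMg.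
- by rewrite -(pi1 pi_mul) -(mor1 pr) keractE conjg1.
- by rewrite -{1}(sK c) -{1}(sK d) -pi_mul -gmulfM keractE conjgM.
Qed.

End KernelModule.

Lemma bij_of_inj_surj (A B : Type) (f : A -> B) : injective f -> surj f -> bijective f.
Proof. by move=> fI /choice[g gK]; exists g => // x; apply: fI. Qed.

(** * The quotient of the free module by the submodule generated by a set *)

Section QuotientModule.

Variables (p : nat) (Q : finGroupType) (X : finType).
Local Notation Z := (freemod (groupring 'F_p Q) X).
Variable S : Z -> Prop.
Local Notation M := (quotmod S).

Definition quotact (m : M) (c : Q) : M := qscale m (gr_elt 'F_p c).

Definition quotpi (z : Z) : M := \pi_M%qT z.

Lemma quotpi_repr (m : M) : quotpi (repr m) = m.
Proof. exact: reprK. Qed.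

Lemma quotpi_eq z z' : quotpi z = quotpi z' <-> (z - z')%R \in rspan S.
Proof. by rewrite Quotient.idealrBE; split=> [/eqP|/eqP]. Qed.

Lemma quotpiD z z' : quotpi (z + z')%R = (quotpi z + quotpi z')%R.
Proof. exact: raddfD. Qed.

Lemma quotactE z c : quotact (quotpi z) c = quotpi (rscale z (gr_elt 'F_p c)).
Proof. exact: pi_rscale. Qed.

Lemma quotact_is_act : is_act quotact.
Proof.
split=> [m m' c|m|m c d].
- rewrite -(quotpi_repr m) -(quotpi_repr m') -quotpiD 3!quotactE rscaleD.
  exact: quotpiD.
- by rewrite -(quotpi_repr m) quotactE rscale1.
- rewrite -(quotpi_repr m) [LHS]quotactE (quotactE (repr m)) quotactE.
  by rewrite rscaleM gr_eltM.
Qed.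

Lemma quotpi_linear : is_rlinear quotact quotpi.
Proof. by split=> *; rewrite ?quotpiD ?quotactE. Qed.

Lemma quotpi_span z : S z -> quotpi z = 0%R.
Proof.
move=> Sz; rewrite -(rlin0 quotpi_linear); apply/quotpi_eq; rewrite subr0.
apply/asboolP; exists 1, (fun=> z), (fun=> 1%R); split=> //.
by rewrite big_ord1 rscale1.
Qed.

Lemma quotmod_tors (hp : prime p) (m : M) : (m *+ p = 0)%R.
Proof.
rewrite -[m]quotpi_repr -(rlinMn quotpi_linear) -(rlin0 quotpi_linear).
congr quotpi; apply/ffunP=> x; apply/ffunP=> c.
by rewrite !ffunMnE !ffunE -mulr_natr pchar_Fp_0 // mulr0.
Qed.

End QuotientModule.

(** * The covering presentation *)

Section Lifting.

Variables (n b p : nat) (D : pcpres n) (lab : labelling n b) (w : 'I_b -> exps n).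
Variables (K : finGroupType) (a : 'I_n -> K) (Q : finGroupType) (pi : K -> Q).
Hypotheses (hp : prime p) (hD : pc_wf D) (ha : pc_rels D a) (hcons : consistent D a).
Hypothesis pi_mul : forall x y, pi (x * y)%g = (pi x * pi y)%g.
Variables (mu : 'I_n -> nat) (hmu : def_rank D lab w mu).
Hypothesis hlast : forall k, last_gen (dexp D lab w k) k.
Hypothesis hleq : forall k, k \notin lset lab -> (ldef lab k).1 <= (ldef lab k).2.
Local Notation Z := (freemod (groupring 'F_p Q) (tails lab)).

(* An abelian extension of K containing an image of G, with a linear map F from
   Z whose values are the tails of the relations lifted to the extension. *)
Record realizes (M : zmodType) (actQ : M -> Q -> M) (F : Z -> M)
    (X : groupType) (pr : {multiplicative X -> K}) (io : M -> X)
    (al : 'I_n -> X) (gX : 'I_b -> X) : Prop := Realizes {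
  rz_act : is_act actQ;
  rz_lin : is_rlinear actQ F;
  rz_ioD : forall m m', io (m + m')%R = (io m * io m')%g;
  rz_ioJ : forall m x, (io m ^ x)%g = io (actQ m (pi (pr x)));
  rz_prio : forall m, pr (io m) = 1%g;
  rz_pral : forall l, pr (al l) = a l;
  rz_rel : forall j k : 'I_n, j <= k ->
    pclhs D al j k = (nword al (pcv D j k) * io (rtail F j k))%g;
  rz_gen : forall l, gX l = sigma (real_gens F io al) w l
}.

(** Definitions are exactly the relations and generator images to which no tail symbol is
    appended. *)
Lemma realizes_defined (M : zmodType) (actQ : M -> Q -> M) (F : Z -> M)
    (X : groupType) (pr : {multiplicative X -> K}) (io : M -> X)
    (al : 'I_n -> X) (gX : 'I_b -> X) :
  realizes actQ F pr io al gX -> forall k, defined D lab w gX al k.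
Proof.
move=> [_ _ ioD _ _ _ rel gen] k; rewrite /defined /dlhs /dexp.
case: ifPn => kX; last by rewrite rel ?hleq // /rtail ytail_def //= (io0 ioD) mulg1.
by rewrite gen (real_sigma F al ioD) ztail_def //= (io0 ioD) mulg1.
Qed.

(* A realization in the kernel of an extension of K by an abelian group on which
   K acts through Q: the generators are lifted so that the definitions hold, and
   the tails are what the other relations then require. *)
Lemma realization_exists (X : groupType) (pr : {multiplicative X -> K})
    (gX : 'I_b -> X) (hab : abelian_kernel pr) (s : Q -> X) :
  surj pr -> (forall l, pr (gX l) = nword a (w l)) ->
  (forall c, pi (pr (s c)) = c) ->
  (forall x y, pr x = 1%g -> pi (pr y) = 1%g -> (x ^ y)%g = x) ->
  (forall x, pr x = 1%g -> (x ^+ p)%g = 1%g) ->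
  exists (F : Z -> kermod hab) (al : 'I_n -> X),
    realizes (keract (hab := hab) s) F pr (kval (hab := hab)) al gX.
Proof.
move=> spr pr_gX sK hcent htors; have hact := keract_is_act hab pi_mul sK hcent.
have tors (m : kermod hab) : (m *+ p = 0)%R.
  apply: kval_inj; transitivity (kval m ^+ p)%g; last exact/htors/pr_kval.
  by elim: p => [|k IHk]; rewrite ?mulr0n // mulrS expgS kvalD IHk.
have [|al pr_al dal] := defined_exists hmu hlast (g := gX) (a := a) spr.
  move=> k; rewrite /defined /dlhs /dexp; case: ifPn => [kX|/hleq jk].
    by rewrite /= pr_gX.
  exact: pclhs_rels.
have alE : pr \o al = a by apply: functional_extensionality_dep.
(* The value of a tail symbol is the defect between the two sides; it lies in the kernel because
   they agree in [K]. *)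
have yP (x : tails lab) : exists y : kermod hab, match x with
    | inl u => pclhs D al (val u).1 (val u).2
    | inr u => gX (val u)
  end = (nword al (match x with
    | inl u => pcv D (val u).1 (val u).2
    | inr u => w (val u)
  end) * kval y)%g.
  case: x => u.
    have h : pr ((nword al (pcv D (val u).1 (val u).2))^-1 *
        pclhs D al (val u).1 (val u).2)%g = 1%g.
      rewrite gmulfM morV mor_nword mor_pclhs alE.
      by rewrite (pclhs_rels ha (yidx_leq u)) mulVg.
    by exists (kmk hab h); rewrite /= mulVKg.
  have h : pr ((nword al (w (val u)))^-1 * gX (val u))%g = 1%g.
    by rewrite gmulfM morV mor_nword alE pr_gX mulVg.
  by exists (kmk hab h); rewrite /= mulVKg.
have {yP}[y yP] := choice yP.
pose F := free_ext (p := p) (keract (hab := hab) s) y.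
have Fy x : F (zsingle x 1%R) = y x by apply: free_ext_single.
exists F, al; split=> //.
- exact: free_ext_linear.
- by move=> m x; rewrite (keractE pi_mul sK hcent).
- exact: pr_kval.
- move=> j k jk; rewrite /rtail; case: (ytailP lab jk) => [[u uE ->]|[-> [k' kX kE]]].
    by have := yP (inl u); rewrite uE /= Fy.
  have := dal k'; rewrite /defined /dlhs /dexp (negPf kX) kE /= => ->.
  by rewrite mulg1.
- move=> l; rewrite (real_sigma F al (@kvalD _ _ _ hab)).
  case: (ztailP lab l) => [[u uE ->]|[-> [k kX kE]]].
    by have := yP (inr u); rewrite uE /= Fy.
  have := dal k; rewrite /defined /dlhs /dexp kX kE /= => ->.
  by rewrite mulg1.
Qed.

(* Two realizations linked by a homomorphism that respects the images of the
   generators of G have corresponding tails, since the definitions determine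
   the lifted generators. *)
Lemma realizes_mor (M M' : zmodType) (actQ : M -> Q -> M) (actQ' : M' -> Q -> M')
    (F : Z -> M) (F' : Z -> M') (X X' : groupType)
    (pr : {multiplicative X -> K}) (pr' : {multiplicative X' -> K})
    (io : M -> X) (io' : M' -> X') al al' gX gX' (f : {multiplicative X -> X'})
    r sec :
  realizes actQ F pr io al gX -> realizes actQ' F' pr' io' al' gX' ->
  transversal_words D (fun l => pi (a l)) r sec ->
  (forall l, f (gX l) = gX' l) -> forall z, f (io (F z)) = io' (F' z).
Proof.
move=> hX hX' hsec f_gX z.
have [_ lin ioD ioJ prio pral rel gen] := hX.
have [_ lin' ioD' ioJ' prio' pral' rel' gen'] := hX'.
have f_al : f \o al =1 al'.
  apply: (defined_unique hmu hlast (g := gX')) => k; last first.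
    exact: (realizes_defined hX').
  have := congr1 f (realizes_defined hX k); rewrite mor_dlhs mor_nword.
  by rewrite /defined /dlhs /= => <-; case: ifP => // _; rewrite /= f_gX.
have f_alE : f \o al = al' by apply: functional_extensionality_dep.
have f_gens : f \o real_gens F io al = real_gens F' io' al'.
  apply: functional_extensionality_dep => -[l|[u|u]] /=; first exact: f_al.
    have := congr1 f (rel _ _ (yidx_leq u)); rewrite gmulfM mor_pclhs mor_nword f_alE.
    by rewrite rel' ?yidx_leq // /rtail ytail_val => /mulgI.
  have := f_gX (val u); rewrite gen gen' !real_sigma // gmulfM mor_nword f_alE.
  by rewrite ztail_val => /mulgI.
rewrite -(real_mod_eval pi_mul lin ioD ioJ pral z hsec).
by rewrite -(real_mod_eval pi_mul lin' ioD' ioJ' pral' z hsec) mor_mod_eval f_gens.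
Qed.

Variables (T : Z -> Prop) (hT : ctest_set D (fun l => pi (a l)) T).

(** Both collections of a test word express the same element of [X] by the same normal word, so the
    tails are equal. *)
Lemma realizes_test (M : zmodType) (actQ : M -> Q -> M) (F : Z -> M)
    (X : groupType) (pr : {multiplicative X -> K}) (io : M -> X) al gX :
  injective io -> realizes actQ F pr io al gX -> forall z, T z -> F z = 0%R.
Proof.
move=> ioI [act lin ioD ioJ _ pral rel _] z Tz; have [Tv _] := hT.
have [u [u' [test value]]] := Tv z Tz.
have [x [e [f [f' [_ r r' ->]]]]] := ctest_value_red hD ha pi_mul act lin test value.
have := real_red ioD ioJ pral rel r.
rewrite (real_red ioD ioJ pral rel r') => /mulgI/ioI ->.
by rewrite subrr (ract0 act).
Qed.

End Lifting.

(** * The isomorphism between the quotient module and the kernel *)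

Theorem theorem5p1
  (b m : nat) (G : groupType) (g : 'I_b -> G)
  (rel : 'I_m -> seq ('I_b * bool)) (hG : presents (fp_rels rel) g)
  (L : seq (nat * nat)) (hL : Llist L)
  (i j p : nat) (hij : i < size L /\ j < (nth (0, 0) L i).2)
  (hp : p = (nth (0, 0) L i).1)
  (K : finGroupType) (hKsol : solvable [set: K])
  (hK : isom_quotient K (@Lterm G L i j))
  (n : nat) (D : pcpres n) (a : 'I_n -> K) (hD : pc_wf D)
  (hDK : presents (pc_rels D) a) (hcons : consistent D a)
  (href : refines L a)
  (lab : labelling n b) (hlab : labelled_pres D lab a)
  (theta : {multiplicative G -> K}) (htheta : surj theta)
  (w : 'I_b -> exps n)
  (hw : forall l, normal_exps D (w l) /\ theta (g l) = nword a (w l))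
  (hlabtheta : labelled_epi lab L a w)
  (P : {group K}) (hP : forall x, x \in P <-> Lterm L i 0 x)
  (r : nat) (hr : r <= n) (hPr : forall x, x \in P <-> tailgrp a r x)
  (H : groupType) (hH : isom_quotient H (@Lterm G L i j.+1))
  (tau : {multiplicative G -> H}) (htau : surj tau)
  (phi : {multiplicative H -> K}) (hphi : surj phi)
  (htheta_tau : forall x, theta x = phi (tau x))
  (Kt : groupType) (h : 'I_n + tails lab -> Kt)
  (hKt : presents
     (fun (H' : groupType) (h' : 'I_n + tails lab -> H') =>
        ext_rels D h' p r) h)
  (sec : coset_of P -> exps n)
  (hsec : transversal_words D (fun l => coset P (a l)) r sec)
  (T U : freemod (groupring 'F_p (coset_of P)) (tails lab) -> Prop)
  (hT : ctest_set D (fun l => coset P (a l)) T)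
  (hU : relator_set rel w sec h U) :
  exists f : quotmod (fun z => T z \/ U z) -> {x : H | phi x == 1%g},
    [/\ bijective f,
        forall x y, val (f (x + y)%R) = (val (f x) * val (f y))%g &
        forall (s : coset_of P -> H), (forall c, coset P (phi (s c)) = c) ->
          forall x c, val (f (qscale x c)) = conj_act s (val (f x)) c].
Proof.
have hp' : prime p.
  have [hLp _] := hL; have [hi _] := hij; rewrite hp.
  by have [] := hLp _ (mem_nth (0, 0) hi).
have [_ ha _] := hDK; have [gG relG univG] := hG.
have [_ _ ldefP _] := hlab.
have wN l : normal_exps D (w l) by have [] := hw l.
have thetaE l : theta (g l) = nword a (w l) by have [] := hw l.
have [mu hmu] := def_rank_exists hD ha hcons href hlab hlabtheta.
have hlast := dexp_last hlab hlabtheta.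
have hleq k : k \notin lset lab -> (ldef lab k).1 <= (ldef lab k).2.
  by case/ldefP.
have Pnorm x : x \in 'N(P)%g.
  rewrite inE; apply/fintype.subsetP=> _ /imsetP[y Py ->].
  by apply/hP/Lterm_conj/hP.
pose Q := coset_of P; pose pi : K -> Q := coset P.
have pi_mul x y : pi (x * y)%g = (pi x * pi y)%g by apply: morphM; apply: Pnorm.
have pi_ker x : pi x = 1%g <-> x \in P.
  by split=> [/(coset_idr (Pnorm x)) | /coset_id].
have abar1 (l : 'I_n) : r <= l -> pi (a l) = 1%g.
  by move=> rl; apply/pi_ker/hPr; apply: gen_incl; exists l.
have ker_theta : forall x, theta x = 1%g <-> Lterm L i j x.
  by apply: (epi_Lterm_kernel (e := @id K) _ hK htheta) => x; exists x.
have LH1 := isom_quotient_Lterm hH.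
have ker_phi x : phi x = 1%g -> Lterm L i j x.
  have [y <-] := htau x; rewrite -htheta_tau => /ker_theta; exact: Lterm_mor.
(* [phi y] lifts to an element of L_{i,0}(G), whose image in [H] differs from [y] by an element of
   the kernel of [phi], hence of L_{i,j}(H). *)
have phi_P y : pi (phi y) = 1%g -> Lterm L i 0 y.
  move=> /pi_ker/hP/(Lterm_mor_onto htheta)[z Lz zE].
  rewrite -(mulVKg (tau z) y); have [_ LM _] := Lterm_subgroup H L i 0.
  apply: LM; first exact: Lterm_mor.
  by apply: (@Lterm_base _ _ _ j); apply: ker_phi; rewrite gmulfM morV -htheta_tau zE mulVg.
(* The commutator lies in L_{i,j+1}(H), which is trivial. *)
have hcent x y : phi x = 1%g -> pi (phi y) = 1%g -> (x ^ y)%g = x.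
  move=> /ker_phi Lx /phi_P Ly; apply/conjg_fixP; apply/eqP; apply: LH1.
  exact: LtermS_comm.
have hab : abelian_kernel phi.
  move=> x y px py; apply/commgP/conjg_fixP/hcent => //.
  by rewrite py (pi1 pi_mul).
have htors x : phi x = 1%g -> (x ^+ p)%g = 1%g.
  by move=> /ker_phi Lx; rewrite hp; apply/LH1/LtermS_pow.
have /choice[s0 s0K] : forall c : Q, exists y, pi (phi y) = c.
  move=> c; have [y yE] := hphi (fingroup.repr c).
  by exists y; rewrite yE; apply: coset_reprK.
have [F [al hF]] := realization_exists hp' ha pi_mul hmu hlast hleq hab
  hphi (fun l => etrans (esym (htheta_tau (g l))) (thetaE l)) s0K hcent htors.
have [actH linH ioDH ioJH prioH pralH relH genH] := hF.
have torsH (x : kermod hab) : (x *+ p = 0)%R.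
  apply: kval_inj; rewrite (ioMn ioDH) (io0 ioDH); exact/htors/pr_kval.
have FT : forall z, T z -> F z = 0%R.
  by apply: (realizes_test hD ha pi_mul hT (@kval_inj _ _ _ hab) hF).
have FU z : U z -> F z = 0%R.
  have [Uv _] := hU; move=> /Uv[l lE]; apply: kval_inj.
  rewrite -(real_relator pi_mul actH linH ioDH ioJH pralH relH hKt torsH abar1 hsec lE).
  rewrite (io0 ioDH) -(mor1 tau) -(relG l) mor_weval.
  by apply: eq_weval => k; rewrite /= genH.
pose S z := T z \/ U z.
have Fspan : forall z, z \in rspan S -> F z = 0%R.
  by apply: (rlin_span actH linH) => z [/FT|/FU].
have F_onto x : phi x = 1%g -> exists z, x = kval (F z).
  apply: (real_generated hD hcons linH ioDH ioJH prioH pralH relH) => {}x.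
  have [y <-] := htau x; apply: gen_mor (gG y) => _ [l ->].
  by exists l; apply: genH.
have ker_tau : forall x, tau x = 1%g <-> Lterm L i j.+1 x.
  have /choice[sp spK] := hphi.
  (* [H] is finite, being covered by pairs of an element of [K] and an element of the finite module
     Z. *)
  pose C : finType := (K * {ffun tails lab -> {ffun Q -> 'F_p}})%type.
  apply: (epi_Lterm_kernel (e := fun c : C => (sp c.1 * kval (F c.2))%g) _ hH htau).
  move=> y; have [|z zE] := F_onto ((sp (phi y))^-1 * y)%g.
    by rewrite gmulfM morV spK mulVg.
  by exists (phi y, z); rewrite /= -zE mulVKg.
have actM := quotact_is_act S; have linM := quotpi_linear S.
have spanM z : S z -> quotpi S z = 0%R by apply: quotpi_span.
have torsM := quotmod_tors (S := S) hp'.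
have kactM := kact_is_act pi_mul actM.
have [E [io [pr [be [[ioI ioD ioJ pr_ker pr_be] [be_pow be_conj]]]]]] :=
  tail_extension hD ha hcons kactM (tests_confluent hD ha pi_mul actM linM hT
    (fun z Tz => spanM z (or_introl Tz))).
have be_rel (k l : 'I_n) : k <= l ->
    pclhs D be k l = (nword be (pcv D k l) * io (rtail (quotpi S) k l))%g.
  rewrite leq_eqVlt /pclhs => /predU1P[/val_inj->|kl]; first by rewrite eqxx.
  by rewrite ifN ?neq_ltn ?kl //; apply: be_conj.
pose gE := sigma (real_gens (quotpi S) io be) w.
have hE : realizes D w a pi (@quotact p Q _ S) (quotpi S) pr io be gE.
  by split=> // q; apply/pr_ker; exists q.
have [psi psiE] : exists psi : {multiplicative G -> E}, forall l, psi (g l) = gE l.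
  apply: univG => l; have [_ /(_ l)[z Uz zE]] := hU.
  rewrite (real_relator pi_mul actM linM ioD ioJ pr_be be_rel hKt torsM abar1 hsec zE).
  by rewrite spanM ?(io0 ioD) //; right.
have pr_psi x : pr (psi x) = theta x.
  have h1 : (pr \o psi : {multiplicative G -> K}) =1 theta.
    apply: (mor_eq_on_gens (g := g)) => [x'|l /=]; first exact: gG.
    rewrite psiE /gE (real_sigma _ be ioD) gmulfM (pr_nword pr_be) thetaE.
    by rewrite [X in (_ * X)%g](_ : _ = 1%g) ?mulg1 //; apply/pr_ker; eexists.
  exact: h1.
have psi_io x : Lterm L i j x -> exists q, psi x = io q.
  by move=> /ker_theta tx; apply/pr_ker; rewrite pr_psi.
(* [psi] maps L_{i,j}(G) into the image of [io], which has exponent dividing [p] and is centralized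
   by the image of L_{i,0}(G). *)
have ker_psi x : Lterm L i j.+1 x -> psi x = 1%g.
  have ksub : is_subgroup (fun x => psi x = 1%g).
    by split=> [|u v eu ev|u eu]; rewrite ?mor1 ?gmulfM ?morV ?eu ?ev ?mulg1 ?invg1.
  move=> [u [v [Au Bv ->]]]; rewrite gmulfM.
  have -> : psi u = 1%g.
    apply: (Au _ ksub) => _ [u' [v' [/psi_io[q qE] Lv ->]]]; rewrite morR qE.
    apply/eqP/conjg_fixP; rewrite ioJ pr_psi /kact.
    suff -> : pi (theta v') = 1%g by rewrite (ract1 actM).
    exact/pi_ker/hP/Lterm_mor.
  rewrite mul1g; apply: (Bv _ ksub) => _ [u' /psi_io[q qE] ->].
  by rewrite morX qE -(ioMn ioD) -hp torsM (io0 ioD).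
have [psi' psi'E] : exists psi' : {multiplicative H -> E}, forall x, psi' (tau x) = psi x.
  by apply: mor_factor htau _ => x /ker_tau/ker_psi.
have F_io : forall z, psi' (kval (F z)) = io (quotpi S z).
  apply: (realizes_mor pi_mul hmu hlast hleq hF hE hsec) => l.
  by rewrite psi'E psiE.
(* One direction recovers the class of [z] from [F z] through [psi'], the other is the vanishing of
   [F] on the span of T and U. *)
have F_eq z z' : F z = F z' <-> quotpi S z = quotpi S z'.
  split=> [eF|/quotpi_eq/Fspan]; first by apply: ioI; rewrite -!F_io eF.
  by rewrite (rlinD linH) (rlinN linH) => /eqP; rewrite subr_eq0 => /eqP.
have F_repr z : F (repr (quotpi S z)) = F z by apply/F_eq/quotpi_repr.
exists (fun q => F (repr q)); split.
- apply: bij_of_inj_surj => [q q' /F_eq|x]; first by rewrite !quotpi_repr.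
  have [|z zE] := F_onto (val x); first exact/eqP/(valP x).
  by exists (quotpi S z); rewrite F_repr; apply: val_inj; rewrite zE.
- move=> q q'; rewrite -(quotpi_repr q) -(quotpi_repr q') -quotpiD.
  by rewrite !F_repr (rlinD linH).
move=> s sK q c; have -> : qscale q c = quotpi S (rscale (repr q) c) by [].
rewrite F_repr (rlin_scale linH) -[LHS]/(kval _) (io_sum ioDH).
apply: eq_bigr => d _; rewrite (ioMn ioDH); congr (_ ^+ _)%g.
(* The action on the kernel was built from [s0]; by [keractE] any other representatives [s] give the
   same. *)
by rewrite -{1}(sK d) (keractE pi_mul s0K hcent).
Qed.
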